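(* Let $\varphi_1,\dots,\varphi_k$ be a hierarchical differential safety condition. Run the iterative synthesis algorithm (described in the context), and let $\mathcal W_i^{\mathrm{alg}}$, $\xi_i^{\mathrm{alg}}$, $\mathcal C_i$ ($1\le i\le k$) and $\hat\xi_j$ ($1\le j\le k$) be the objects it computes. Then: 1. For every $i\in\{1,\dots,k\}$, the algorithm computes the set $\mathcal W_i$ of winning windows at level $i$ and the restriction of the safe-action map $\xi_i$ to $\mathcal W_i$; that is, $\mathcal W_i^{\mathrm{alg}}=\mathcal W_i$ and $\xi_i^{\mathrm{alg}}(\bar s)=\xi_i(\bar s)$ for all $\bar s\in\mathcal W_i$. 2. In particular, iterative synthesis yields the same maximally permissive winning strategy for $\mathfrak G_{\varphi_k}$ as direct synthesis, if it exists. 3. Moreover, the strategy $\sigma$ defined by $\sigma(w)=\hat\xi_{|w|}(w)$ for $|w|<k$ and $\sigma(w)=\xi_k^{\mathrm{alg}}(w_{|w|-k+1:|w|})$ for $|w|\ge k$ is the maximally permissive winning strategy for the turn-based game $(\mathcal S,\mathcal A,\mathsf T,\mathcal F_{\varphi_1,\dots,\varphi_k},s_{\mathrm{init}})$ with the hierarchical winning condition $\mathcal F_{\varphi_1,\dots,\varphi_k}=\{w\in\mathcal S^\omega:\forall t\in\mathbb N_+,\ [\![\varphi_{\min\{t,k\}}]\!]_t(w)=\top\}$. 4. The time complexity is $\mathcal O\bigl(\sum_{i=1}^k|\mathcal C_i|\cdot|\mathcal A|\cdot|\mathcal S|\bigr)\subseteq\mathcal O(|\mathcal S|^{k+1}\cdot|\mathcal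 A|)$.
   Context: **Sequences.** $\mathbb N=\{0,1,2,\dots\}$, $\mathbb N_+=\{1,2,\dots\}$. For a set $\mathcal S$, $\mathcal S^*$ and $\mathcal S^\omega$ are the finite and infinite sequences over $\mathcal S$, $\mathcal S^\infty=\mathcal S^*\cup\mathcal S^\omega$, and $\mathcal S^{\le k}$ is the set of sequences of length at most $k$. For $w=s_1s_2\cdots$, $|w|$ is its length and $w_{m:n}=s_m\cdots s_n$. **Discrete derivatives.** $\mathcal S\subseteq\mathbb R^d$ is finite and $\Delta\tau>0$ is a fixed time step. For $w=s_1s_2\cdots\in\mathcal S^\infty$, $\partial^0_t(w)=s_t$ and $\partial^k_t(w)=(\partial^{k-1}_t(w)-\partial^{k-1}_{t-1}(w))/\Delta\tau$, for $k<t\le|w|$. **Differential safety properties.** These are the formulas $\varphi::=(\partial^k\in\mathcal R)\mid\varphi\land\varphi\mid\lnot\varphi$ with $k\in\mathbb N$, $\mathcal R\subseteq\mathbb R^d$. The order $\mathrm{ord}(\varphi)$ is the largest $k$ occurring in an atom $(\partial^k\in\mathcal R)$ of $\varphi$. For $\mathrm{ord}(\varphi)+1\le t\le|w|$, the local value $[\![\varphi]\!]_t(w)\in\{\top,\bot\}$ is defined by: $[\![\partial^j\in\mathcal R]\!]_t(w)=\top$ iff $\partial^j_t(w)\in\mathcal R$, extended to Boolean connectives as usual. Globally, for $\mathrm{ord}(\varphi)=m$, $w\models\varphi$ iff $[\![\varphi]\!]_t(w)=\top$ for all $t$ with $m+1\le t\le|w|$. **Games and strategies.** A turn-based game is $(\mathcal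 S,\mathcal A,\mathsf T,\mathcal F,s_{\mathrm{init}})$ with finite state set $\mathcal S$, finite nonempty action set $\mathcal A$, $\mathsf T\colon\mathcal S\times\mathcal A\to2^{\mathcal S}$ with all values nonempty, winning condition $\mathcal F\subseteq\mathcal S^\omega$, and $s_{\mathrm{init}}\in\mathcal S$. Throughout, $\mathcal S,\mathcal A,\mathsf T,s_{\mathrm{init}}$ are fixed. Write $s\xrightarrow{a}s'$ if $s'\in\mathsf T(s,a)$, and $s\to s'$ if this holds for some $a$. A path is $w=s_1s_2\cdots\in\mathcal S^\omega$ with $s_t\to s_{t+1}$ for all $t$; it is winning if $w\in\mathcal F$. $\mathfrak G_\varphi$ denotes the game with $\mathcal F=\mathcal F_\varphi=\{w\in\mathcal S^\omega:w\models\varphi\}$. A strategy is a map $\xi\colon\mathcal S^*\to2^{\mathcal A}$. A sequence $w=s_1s_2\cdots\in\mathcal S^\infty$ is consistent with $\xi$ if for every $t<|w|$ there is $a\in\xi(w_{1:t})$ with $s_t\xrightarrow{a}s_{t+1}$. $\xi$ is winning if $\xi(w)\ne\emptyset$ for every finite sequence $w$ starting in $s_{\mathrm{init}}$ that is consistent with $\xi$, and every path starting from $s_{\mathrm{init}}$ consistent with $\xi$ is winning. $\xi$ subsumes $\xi'$ if every path consistent with $\xi'$ is also consistent with $\xi$. A winning strategy is maximally permissive if it subsumes every winning strategy. **Hierarchy.** A sequence $\varphi_1,\dots,\varphi_k$ of differential safety properties with $\mathrm{ord}(\varphi_i)=i-1$ is a hierarchical differential safety condition if for all $i\in\{2,\dots,k\}$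 and $(s_1,\dots,s_i)\in\mathcal S^i$: $[\![\varphi_i]\!]_i(s_1,\dots,s_i)=\top$ implies $[\![\varphi_{i-1}]\!]_{i-1}(s_2,\dots,s_i)=\top$. **Winning windows.** A window $(s_1,\dots,s_i)\in\mathcal S^i$ is winning at level $i$ if the controller has a strategy that always permits at least one action and guarantees $[\![\varphi_i]\!]_t(w)=\top$ for all $t\ge i$ along every consistent infinite extension $w=s_1\cdots s_is_{i+1}\cdots$ (consistency being required for the steps from time $i$ on). $\mathcal W_i\subseteq\mathcal S^i$ is the set of winning windows, and $\xi_i(s_1,\dots,s_i)=\{a\in\mathcal A:\forall s'\in\mathsf T(s_i,a),\ (s_2,\dots,s_i,s')\in\mathcal W_i\}$. **Iterative synthesis algorithm.** Set $\mathcal W_0^{\mathrm{alg}}=\{()\}$ and $\xi_0^{\mathrm{alg}}(())=\mathcal A$. For $i=1,\dots,k$: (a) Set $\mathcal U=\emptyset$ and $\xi_i^{\mathrm{alg}}(\bar s)=\emptyset$ for all $\bar s\in\mathcal S^i$ (stored lazily with default $\emptyset$). (b) $\mathcal C_i=\{(s_1,\dots,s_i)\in\mathcal S^i:[\![\varphi_i]\!]_i(s_1,\dots,s_i)=\top,\ (s_2,\dots,s_i)\in\mathcal W_{i-1}^{\mathrm{alg}}\}$. (c) For each $(s_1,\dots,s_i)\in\mathcal C_i$ set $\xi_i^{\mathrm{alg}}(s_1,\dots,s_i)=\{a\in\xi_{i-1}^{\mathrm{alg}}(s_2,\dots,s_i):\forall s'\in\mathsf T(s_i,a),\ (s_2,\dots,s_i,s')\in\mathcal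 C_i\}$; if it is empty, insert the window into $\mathcal U$. (d) While $\mathcal U\ne\emptyset$: remove some $\bar s=(s_1,\dots,s_i)$ from $\mathcal U$; for every $a\in\mathcal A$ and every $\bar s'=(s_1',\dots,s_i')\in\mathcal C_i$ with $(s'_2,\dots,s'_i)=(s_1,\dots,s_{i-1})$ and $s_i\in\mathsf T(s'_i,a)$: if $\xi_i^{\mathrm{alg}}(\bar s')=\{a\}$ insert $\bar s'$ into $\mathcal U$; then remove $a$ from $\xi_i^{\mathrm{alg}}(\bar s')$. (e) $\mathcal W_i^{\mathrm{alg}}=\{\bar s\in\mathcal C_i:\xi_i^{\mathrm{alg}}(\bar s)\ne\emptyset\}$. Afterwards (transient pass): $\hat\xi_k=\xi_k^{\mathrm{alg}}$, and for $j=k-1,\dots,1$ and all $(s_1,\dots,s_j)\in\mathcal S^j$, $\hat\xi_j(s_1,\dots,s_j)=\{a\in\mathcal A:[\![\varphi_j]\!]_j(s_1,\dots,s_j)=\top\text{ and }\forall s'\in\mathsf T(s_j,a),\ \hat\xi_{j+1}(s_1,\dots,s_j,s')\ne\emptyset\}$. Return $(\mathcal W_k^{\mathrm{alg}},\xi_k^{\mathrm{alg}},\hat\xi_{k-1},\dots,\hat\xi_1)$. As a strategy for $\mathfrak G_{\varphi_k}$, iterative synthesis acts through the action sets $\xi_k^{\mathrm{alg}}$ of the current window of the last $k$ states. **Direct synthesis** means applying the following algorithm to the top-level property $\varphi=\varphi_k$, of order $m=k-1$. (The algorithm is stated for $m\ge1$; for $m=0$ the winning condition is a state invariant and the game is a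 classical safety game.) It computes $\xi\colon\mathcal S^{\le m}\to2^{\mathcal A}$ using a set $\mathcal U$ of histories, initially empty: (1) $\xi(h)=\mathcal A$ for $|h|\le m-1$. (2) For $(s_1,\dots,s_m)\in\mathcal S^m$, $\xi(s_1,\dots,s_m)=\{a\in\mathcal A:\forall s'\in\mathsf T(s_m,a),\ [\![\varphi]\!]_{m+1}(s_1,\dots,s_m,s')=\top\}$; if empty, insert the history into $\mathcal U$. (3) While $\mathcal U\ne\emptyset$, remove some $(s_1,\dots,s_j)$ from $\mathcal U$; for each $a\in\mathcal A$ let $\bar S=\{(s_1,\dots,s_{j-1})\}$ if $1<j<m$ and $s_{j-1}\xrightarrow{a}s_j$; else $\bar S=\{(s_1,\dots,s_{m-1})\}\cup\{(s',s_1,\dots,s_{m-1}):s'\to s_1\}$ if $j=m\ge2$ and $s_{m-1}\xrightarrow{a}s_m$; else $\bar S=\emptyset$; for each $\bar s\in\bar S$, if $\xi(\bar s)=\{a\}$ insert $\bar s$ into $\mathcal U$, then remove $a$ from $\xi(\bar s)$. The resulting strategy applies $\xi$ to the last $\min\{|w|,m\}$ states of a history $w$. **Cost convention.** Membership in the sets $\mathcal R$ is decided in constant time, and evaluation of $[\![\varphi_i]\!]_t$ on a window is treated as constant time.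
   Formalization: Subsumption compares only paths from s_init; item 3 assumes a winning strategy exists; for k=2 direct synthesis gets a predecessor clause (as written, item 2 holds if its strategy wins); item 4's first bound assumes a nonzero sum; its second constant may depend on k. *)

(* Defs.v *)
From HB Require Import structures.
From mathcomp Require Import all_boot all_order all_algebra finmap.
From mathcomp Require Import boolp classical_sets reals.
From mathcomp Require Import finset.

Set Implicit Arguments.
Unset Strict Implicit.
Unset Printing Implicit Defensive.

Import GRing.Theory.

(* Positions in a sequence are numbered from 1, as in s_1 s_2 ... ; an infinite
   sequence is a function w on nat with s_t = w t.-1. *)
Inductive word (X : Type) := Fin of seq X | Inf of (nat -> X).

Section Words.
Variable X : Type.

Definition within (t : nat) (w : word X) : bool :=
  if w is Fin s then t <= size s else true.

Definition wnth (w : word X) (t : nat) : option X :=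
  match w with Fin s => onth s t.-1 | Inf f => Some (f t.-1) end.

Definition wprefix (w : word X) (t : nat) : seq X :=
  match w with Fin s => take t s | Inf f => mkseq f t end.

End Words.

(* The tuple (S, A, T, s_init); a game is an arena together with a winning
   condition, a predicate on infinite sequences of states. *)
Record arena (R : realType) (d : nat) := Arena {
  states : {fset 'rV[R]_d};
  actions : finType;
  trans : states -> actions -> {set states};
  init : states;
  actions_neq0 : 0 < #|actions|;
  trans_neq0 : forall s a, trans s a != set0
}.

Inductive dsp (R : realType) (d : nat) :=
| Atom of nat & set 'rV[R]_d
| And of dsp R d & dsp R d
| Not of dsp R d.

Fixpoint ord (R : realType) (d : nat) (phi : dsp R d) : nat :=
  match phi with
  | Atom k _ => k
  | And phi1 phi2 => maxn (ord phi1) (ord phi2)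
  | Not phi1 => ord phi1
  end.

Section Properties.
Variables (R : realType) (d : nat) (dtau : R) (S : {fset 'rV[R]_d}).

(* The values at positions outside 1, ..., |w| are junk, as is the derivative
   of order k at t <= k. *)
Definition letter (w : word S) (t : nat) : 'rV[R]_d :=
  if wnth w t is Some s then val s else 0%R.

Fixpoint deriv (k : nat) (w : word S) (t : nat) : 'rV[R]_d :=
  if k is k'.+1 then (dtau^-1 *: (deriv k' w t - deriv k' w t.-1))%R
  else letter w t.

Fixpoint sat (phi : dsp R d) (t : nat) (w : word S) : bool :=
  match phi with
  | Atom k Z => deriv k w t \in Z
  | And phi1 phi2 => sat phi1 t w && sat phi2 t w
  | Not phi1 => ~~ sat phi1 t w
  end.

Definition models (w : word S) (phi : dsp R d) : Prop :=
  forall t, ord phi < t -> within t w -> sat phi t w.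

(* phi i is the i-th property, 1 <= i <= k; other values of phi are unused. *)
Definition hierarchical (k : nat) (phi : nat -> dsp R d) : Prop :=
  (forall i, 0 < i <= k -> ord (phi i) = i.-1) /\
  (forall i, 1 < i <= k -> forall s : i.-tuple S,
     sat (phi i) i (Fin s) -> sat (phi i.-1) i.-1 (Fin (behead s))).

End Properties.

Section Games.
Variables (R : realType) (d : nat) (G : arena R d).
Local Notation S := (states G).
Local Notation A := (actions G).

Definition strategy := seq S -> {set A}.

Definition consistent_from (i : nat) (xi : strategy) (w : word S) : Prop :=
  forall t s s', i <= t -> wnth w t = Some s -> wnth w t.+1 = Some s' ->
    exists2 a, a \in xi (wprefix w t) & s' \in trans s a.

Definition consistent := consistent_from 1.

Definition path_of (w : nat -> S) : Prop :=
  forall n, exists a, w n.+1 \in trans (w n) a.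

Definition winning (F : (nat -> S) -> Prop) (xi : strategy) : Prop :=
  (forall h : seq S, ohead h = Some (init G) -> consistent xi (Fin h) ->
     xi h != set0) /\
  (forall w : nat -> S, w 0 = init G -> path_of w -> consistent xi (Inf w) ->
     F w).

(* Only the plays of the game, i.e. the paths from the initial state, are
   compared: a winning strategy is arbitrary on all other histories. *)
Definition subsumes (xi xi' : strategy) : Prop :=
  forall w : nat -> S, w 0 = init G -> path_of w ->
    consistent xi' (Inf w) -> consistent xi (Inf w).

Definition max_permissive (F : (nat -> S) -> Prop) (xi : strategy) : Prop :=
  winning F xi /\ forall xi', winning F xi' -> subsumes xi xi'.

Variable dtau : R.

Definition F_dsp (phi : dsp R d) (w : nat -> S) : Prop :=
  models dtau (Inf w) phi.

Definition F_hier (k : nat) (phi : nat -> dsp R d) (w : nat -> S) : Prop :=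
  forall t, 0 < t -> sat dtau (phi (minn t k)) t (Inf w).

Definition winning_window (phi : dsp R d) (i : nat) (s : i.-tuple S) : Prop :=
  exists xi : strategy, (forall h, xi h != set0) /\
    forall w : nat -> S, wprefix (Inf w) i = s -> consistent_from i xi (Inf w) ->
      forall t, i <= t -> sat dtau phi t (Inf w).

Definition winning_windows (phi : dsp R d) (i : nat) : {set i.-tuple S} :=
  [set s : i.-tuple S | `[< winning_window phi s >] ].

End Games.

(* The loop shared by both synthesis algorithms. The state is the worklist and
   the current map of permitted actions; back h a is the set of entries that
   lose the action a when h is removed from the worklist. The removed element
   and the order of the inner traversal are arbitrary. *)
Section Worklist.
Variables (H A : finType) (back : H -> A -> {set H}).

Definition wl_state := ({set H} * {ffun H -> {set A}})%type.

Definition visit (st : wl_state) (p : A * H) : wl_state :=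
  let: (U, xi) := st in
  let: (a, h) := p in
  (if xi h == [set a] then h |: U else U,
   [ffun h' => if h' == h then xi h :\ a else xi h']).

Inductive wl_step : wl_state -> wl_state -> Prop :=
| WlStep (U : {set H}) (xi : {ffun H -> {set A}}) h (l : seq (A * H)) :
    h \in U ->
    perm_eq l (enum [set p : A * H | p.2 \in back h p.1]) ->
    wl_step (U, xi) (foldl visit (U :\ h, xi) l).

(* wl_run st xi n: from st, the loop can end with the map xi after n removals. *)
Inductive wl_run : wl_state -> {ffun H -> {set A}} -> nat -> Prop :=
| WlDone xi : wl_run (set0, xi) xi 0
| WlMore st st' xi n : wl_step st st' -> wl_run st' xi n -> wl_run st xi n.+1.

Definition wl_terminates : Prop := well_founded (fun st' st => wl_step st st').

End Worklist.

Section Iterative.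
Variables (R : realType) (d : nat) (G : arena R d) (dtau : R).
Variables (k : nat) (phi : nat -> dsp R d).
Local Notation S := (states G).
Local Notation A := (actions G).

Definition tlast (i : nat) (s : i.+1.-tuple S) : S := tnth s ord_max.
Definition shift (i : nat) (s : i.+1.-tuple S) (s' : S) : i.+1.-tuple S :=
  [tuple of rcons (behead s) s'].

Definition safe_actions (i : nat) (s : i.+1.-tuple S) : {set A} :=
  [set a | [forall s' in trans (tlast s) a,
      shift s s' \in winning_windows G dtau (phi i.+1) i.+1]].

Record synthesis := Synthesis {
  win : forall i, {set i.-tuple S};
  cand : forall i, {set i.-tuple S};
  act : forall i, {ffun i.-tuple S -> {set A}};
  hat : forall i, {ffun i.-tuple S -> {set A}};
  pops : nat -> nat   (* worklist removals performed at each level *)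
}.

Definition candidates (i : nat) (W : {set i.-tuple S}) : {set i.+1.-tuple S} :=
  [set s : i.+1.-tuple S |
    sat dtau (phi i.+1) i.+1 (Fin s) & [tuple of behead s] \in W].

Definition iter_init (i : nat) (xi : {ffun i.-tuple S -> {set A}})
    (C : {set i.+1.-tuple S}) : {ffun i.+1.-tuple S -> {set A}} :=
  [ffun s : i.+1.-tuple S => if s \in C then
     [set a in xi [tuple of behead s] |
       [forall s' in trans (tlast s) a, shift s s' \in C]]
   else set0].

Definition iter_back (i : nat) (C : {set i.+1.-tuple S})
    (s : i.+1.-tuple S) (a : A) : {set i.+1.-tuple S} :=
  [set s' in C | (behead s' == take i s) && (tlast s \in trans (tlast s') a)].

Definition hat_step (i : nat) (xi : {ffun i.+2.-tuple S -> {set A}}) :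
    {ffun i.+1.-tuple S -> {set A}} :=
  [ffun s : i.+1.-tuple S => [set a | sat dtau (phi i.+1) i.+1 (Fin s) &
     [forall s' in trans (tlast s) a, xi [tuple of rcons s s'] != set0]]].

Definition iterative_synthesis (o : synthesis) : Prop :=
  [/\ win o 0 = setT /\ act o 0 = [ffun=> setT],
      forall i, i < k ->
        let C := cand o i.+1 in
        let xi0 := iter_init (act o i) C in
        [/\ C = candidates (win o i),
            wl_run (iter_back C) ([set s in C | xi0 s == set0], xi0)
              (act o i.+1) (pops o i.+1)
          & win o i.+1 = [set s in C | act o i.+1 s != set0]],
      hat o k = act o k
    & forall i, i.+1 < k -> hat o i.+1 = hat_step (hat o i.+2)].

(* Number of loop body executions, each of which takes constant time when
   formula evaluations, table look-ups and set updates do. Since maps are stored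
   with default set0, the loops only range over stored entries: the candidates
   are generated by prefixing each window of win o i with each state, the
   predecessors of a removed window by prefixing each state, and hat o i.+1 is
   only evaluated at the prefixes of windows where hat o i.+2 is nonempty, all
   its other values being set0 because trans has nonempty values. *)
Definition level_cost (o : synthesis) (i : nat) : nat :=
  \sum_(v in win o i) \sum_(s : S) 1
  + \sum_(s in cand o i.+1)
      (1 + \sum_(a in act o i [tuple of behead s]) (1 + #|trans (tlast s) a|))
  + pops o i.+1 * (1 + \sum_(a : A) \sum_(s : S) 1)
  + \sum_(s in cand o i.+1) 1.

Definition stored (i : nat) (xi : {ffun i.-tuple S -> {set A}}) :
    {set i.-tuple S} := [set s | xi s != set0].

Definition hat_cost (o : synthesis) (i : nat) : nat :=
  \sum_(s in stored (hat o i.+2)) 1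
  + \sum_(s : i.+1.-tuple S
          | [exists s', [tuple of rcons s s'] \in stored (hat o i.+2)])
      (1 + \sum_(a : A) (1 + #|trans (tlast s) a|)).

Definition cost (o : synthesis) : nat :=
  \sum_(i < k) level_cost o i + \sum_(i < k.-1) hat_cost o i.

Definition lookup (i : nat) (xi : {ffun i.-tuple S -> {set A}}) (s : seq S) :
    {set A} := if insub s is Some t then xi t else set0.

(* Follow pre on histories shorter than k, and the actions permitted at the
   window of the last k states afterwards. *)
Definition window_strategy (pre : strategy G)
    (xi : {ffun k.-tuple S -> {set A}}) : strategy G :=
  fun w => if size w < k then pre w else lookup xi (drop (size w - k) w).

Definition hat_strategy (o : synthesis) : strategy G :=
  fun w => lookup (hat o (size w)) w.

End Iterative.

Section Direct.
Variables (R : realType) (d : nat) (G : arena R d) (dtau : R).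
Local Notation S := (states G).
Local Notation A := (actions G).

Definition direct_init (m : nat) (phi : dsp R d) :
    {ffun m.-bseq S -> {set A}} :=
  [ffun h : m.-bseq S => if size h < m then setT else
     [set a | [forall s' in trans (last (init G) h) a,
                 sat dtau phi m.+1 (Fin (rcons h s'))]]].

Definition direct_back_ge2 (m : nat) (h : m.-bseq S) (a : A) :
    {set m.-bseq S} :=
  let j := size h in
  let pre := take j.-1 h in
  let moves := nth (init G) h j.-1 \in trans (nth (init G) h j.-2) a in
  if (1 < j < m) && moves then [set h' : m.-bseq S | h' == pre :> seq S]
  else if (j == m) && (1 < m) && moves then
    [set h' : m.-bseq S | (h' == pre :> seq S) ||
       [exists s', [exists b, nth (init G) h 0 \in trans s' b]
                   && (h' == s' :: pre :> seq S)]]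
  else set0.

(* For m = 1 the clauses above propagate nothing. Here the single-state history
   h then removes the action a from each state that can reach h by a. *)
Definition direct_back (m : nat) (h : m.-bseq S) (a : A) : {set m.-bseq S} :=
  if m == 1 then
    [set h' : m.-bseq S | [exists s, [exists s',
       [&& h == [:: s] :> seq S, h' == [:: s'] :> seq S & s \in trans s' a]]]]
  else direct_back_ge2 h a.

(* The classical solution of a safety game, for a property of order 0: the
   largest set of safe states in which the controller can remain. *)
Definition safety_region (phi : dsp R d) : {set S} :=
  \bigcup_(Z : {set S} | Z \subset [set s | sat dtau phi 1 (Fin [:: s]) &
                           [exists a, trans s a \subset Z]]) Z.

Definition safety_strategy (phi : dsp R d) : strategy G :=
  fun w => [set a | trans (last (init G) w) a \subset safety_region phi].

Definition direct_synthesis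
    (back : forall m, m.-bseq S -> A -> {set m.-bseq S})
    (phi : dsp R d) (D : strategy G) : Prop :=
  let m := ord phi in
  if m == 0 then D = safety_strategy phi else
  exists (xi : {ffun m.-bseq S -> {set A}}) (n : nat),
    let xi0 := direct_init m phi in
    wl_run (back m)
      ([set h : m.-bseq S | (size h == m) && (xi0 h == set0)], xi0) xi n /\
    D = (fun w => xi (insub_bseq m (drop (size w - m) w))).

End Direct.

(* Main.v *)
Require Import Defs.
From HB Require Import structures.
From mathcomp Require Import all_boot all_order all_algebra finmap.
From mathcomp Require Import boolp classical_sets reals.
From mathcomp Require Import fintype finset zify.
Set Implicit Arguments.
Unset Strict Implicit.
Unset Printing Implicit Defensive.
Import Order.TTheory GRing.Theory Num.Theory.

(** For a condition that constrains the finite prefixes of a play, let a history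
    be safe when the controller can keep all its extensions inside the condition,
    and let [sigma] permit exactly the actions all of whose outcomes are safe.
    When some winning strategy exists, a strategy is winning and maximally
    permissive iff, on every history that [sigma] reaches, it permits only actions
    of [sigma] and allows every move that [sigma] allows.
    A differential property of order less than [i] only sees the last [i] states,
    so safety of a history of length at least [i] only depends on that window.
    The worklist loop computes the greatest family of action sets below its initial
    family that is closed under "no permitted action leads to an emptied entry";
    closure makes its result sound, and being greatest makes it complete.  The
    hierarchy implies that a safe window of level [i + 1] is safe at level [i], so
    pruning with the previous level discards nothing.
    For the complexity, each candidate enters the worklist at most once, and the
    windows stored by the transient pass at level [j] are safe for [phi j], hence
    candidates of that level. *)

(** * The worklist loop *)

Section WorklistTheory.
Variables (H A : finType) (back : H -> A -> {set H}).
Implicit Types (st : wl_state H A) (xi : {ffun H -> {set A}}).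

Definition potential st := #|st.1| + #|[set h | st.2 h != set0]|.

Lemma potential_visit st p : potential (visit st p) <= potential st.
Proof.
case: st p => [U xi] [a h]; rewrite /potential /=.
set xi' := [ffun _ => _].
have sub : [set h | xi' h != set0] \subset [set h | xi h != set0].
  apply/subsetP=> x; rewrite !inE ffunE; case: (eqVneq x h) => [->|_ //].
  by apply: contra => /eqP->; rewrite set0D.
case: ifP => [/eqP xih|_]; last by rewrite leq_add2l subset_leq_card.
have hin : h \in [set h | xi h != set0].
  by rewrite inE xih -card_gt0 cards1.
have : [set h | xi' h != set0] \subset [set h | xi h != set0] :\ h.
  apply/subsetP=> x xin; rewrite in_setD1 (subsetP sub _ xin) andbT.
  by apply: contraTneq xin => ->; rewrite inE ffunE eqxx xih setDv eqxx.
move=> /subset_leq_card; rewrite (cardsD1 h [set h | xi h != set0]) hin.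
by move=> le; rewrite cardsU1; case: (_ \notin _) => /=; lia.
Qed.

Lemma visit_ind (P : wl_state H A -> Prop) l st :
    (forall st p, p \in l -> P st -> P (visit st p)) ->
  P st -> P (foldl (@visit H A) st l).
Proof.
elim: l st => //= p l IHl st Pvisit Pst; apply: IHl.
  by move=> st' q ql; apply: Pvisit; rewrite inE ql orbT.
by apply: Pvisit => //; rewrite inE eqxx.
Qed.

Lemma potential_step st st' : wl_step back st st' -> potential st' < potential st.
Proof.
case=> U xi h l hU _.
apply: (@leq_ltn_trans (potential (U :\ h, xi))); last first.
  by rewrite /potential /= (cardsD1 h U) hU.
apply: (@visit_ind (fun st => potential st <= potential (U :\ h, xi))) => // st'' p _.
exact/leq_trans/potential_visit.
Qed.

Lemma worklist_terminates : wl_terminates back.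
Proof.
move=> st; have [n] := ubnP (potential st).
elim: n st => [|n IHn] st lt_n; first by rewrite ltn0 in lt_n.
by apply: Acc_intro => st' /potential_step lt; apply/IHn/(leq_trans lt).
Qed.

Lemma wl_run_exists st : exists xi n, wl_run back st xi n.
Proof.
elim: (worklist_terminates st) => -[U xi] _ IH.
have [->|/set0Pn [h hU]] := eqVneq U set0; first by exists xi, 0; constructor.
have step := WlStep xi hU (perm_refl (enum [set p : A * H | p.2 \in back h p.1])).
by have [xi' [n run]] := IH _ step; exists xi', n.+1; apply: WlMore run.
Qed.

Lemma wl_run_potential st xi n : wl_run back st xi n -> n <= potential st.
Proof.
by elim=> {st xi n} [//|st st' xi n /potential_step lt _ /leq_ltn_trans]; apply.
Qed.

Lemma wl_run_ind (P : wl_state H A -> Prop) st xi n :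
    (forall (U : {set H}) xi h (l : seq (A * H)), h \in U ->
       l =i [set p : A * H | p.2 \in back h p.1] ->
       P (U, xi) -> P (foldl (@visit H A) (U :\ h, xi) l)) ->
  wl_run back st xi n -> P st -> P (set0, xi).
Proof.
move=> Pstep; elim=> {st xi n} [//|st st' xi n step _ IH Pst]; apply: IH.
case: step Pst => U xi' h l hU eq_l; apply: Pstep => // p.
by rewrite (perm_mem eq_l) mem_enum.
Qed.

Lemma visit_sub st p h : (visit st p).2 h \subset st.2 h.
Proof.
by case: st p => [U xi] [a h'] /=; rewrite ffunE; case: eqP => [->|//]; rewrite subD1set.
Qed.

Lemma visits_remove st l a h : (a, h) \in l -> a \notin (foldl (@visit H A) st l).2 h.
Proof.
elim: l st => //= p l IHl st; rewrite inE => /orP [/eqP <-|]; last exact: IHl.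
apply: (@visit_ind (fun st => a \notin st.2 h)) => [st' q _|].
  by apply: contra; apply/subsetP/visit_sub.
by case: st => U xi /=; rewrite ffunE eqxx setD11.
Qed.

Lemma wl_run_sub st xi n h : wl_run back st xi n -> xi h \subset st.2 h.
Proof.
move=> run; apply: (wl_run_ind (P := fun st' => st'.2 h \subset st.2 h) _ run) => //.
move=> U xi' h' l _ _ sub /=; apply: (@visit_ind (fun st' => st'.2 h \subset st.2 h)) => // st' p _.
exact/subset_trans/visit_sub.
Qed.

Definition worklist_empty st := forall h, h \in st.1 -> st.2 h = set0.

Lemma worklist_empty_visit st p : worklist_empty st -> worklist_empty (visit st p).
Proof.
case: st p => U xi [a h] emp h' /=; rewrite ffunE; case: (eqVneq h' h) => [->|ne].
  by case: ifP => [/eqP-> _|_ /emp /= ->]; rewrite ?setDv ?set0D.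
by case: ifP => _; rewrite ?in_setU1 ?(negbTE ne) => /emp.
Qed.

Lemma worklist_empty_visits U xi h l : worklist_empty (U, xi) ->
  worklist_empty (foldl (@visit H A) (U :\ h, xi) l).
Proof.
move=> emp; apply: (@visit_ind worklist_empty) => [? ? _|]; first exact: worklist_empty_visit.
by move=> h' /setD1P [_ /emp].
Qed.

Lemma wl_run_max U xi0 xi n (eta : H -> {set A}) :
    worklist_empty (U, xi0) -> wl_run back (U, xi0) xi n ->
    (forall h, eta h \subset xi0 h) ->
    (forall h h' a, a \in eta h -> h \in back h' a -> eta h' != set0) ->
  forall h, eta h \subset xi h.
Proof.
move=> emp run sub0 closed.
pose P st := worklist_empty st /\ forall h, eta h \subset st.2 h.
suff [] : P (set0, xi) by [].
apply: (wl_run_ind (P := P) _ run) => //.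
move=> {run emp sub0 n U xi}U xi h l hU eq_l [emp sub].
split; first exact: worklist_empty_visits.
apply: (@visit_ind (fun st => forall h, eta h \subset st.2 h)) => // -[U' xi'] [a h'].
rewrite eq_l inE /= => back_h sub' h''; rewrite ffunE.
case: eqP => [->|_]; last exact: sub'.
rewrite subsetD1 sub'; apply/negP => /closed /(_ back_h).
by rewrite -subset0 -(emp h hU) sub.
Qed.

Lemma wl_run_closed (D U : {set H}) xi0 xi n :
    (forall h, h \in D -> xi0 h = set0 -> h \in U) ->
    wl_run back (U, xi0) xi n ->
  forall h h' a, h' \in D -> h \in back h' a -> a \in xi h -> xi h' != set0.
Proof.
move=> DU run.
pose done st h := forall a h', h' \in back h a -> a \notin st.2 h'.
pose P st := forall h, h \in D -> st.2 h = set0 -> h \in st.1 \/ done st h.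
suff PF : P (set0, xi).
  move=> h h' a h'D hb ah; apply/eqP => xi0h'.
  by case: (PF h' h'D xi0h') => [|/(_ _ _ hb)]; rewrite ?inE //= ah.
apply: (wl_run_ind (P := P) _ run); last by move=> h hD h0; left; apply: DU.
move=> {run DU}U {}xi h l hU eq_l PU.
pose Q st := forall h', h' \in D -> st.2 h' = set0 -> [\/ h' \in st.1, done st h' | h' = h].
have : Q (foldl (@visit H A) (U :\ h, xi) l).
  apply: (@visit_ind Q) => [[U' xi'] [a h2] _ QU h' h'D|h' h'D /= h'0].
    have sub := visit_sub (U', xi') (a, h2).
    have donev h1 : done (U', xi') h1 -> done (visit (U', xi') (a, h2)) h1.
      by move=> dn b h3 /dn /=; apply: contra; apply/subsetP/sub.
    have [h'0 _|ne] := eqVneq (xi' h') set0.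
      case: (QU h' h'D h'0) => [h'U|dn|]; [constructor 1|constructor 2|by constructor 3].
        by move: h'U => /= h'U; case: ifP => _; rewrite ?inE //= h'U orbT.
      exact: donev.
    rewrite /= ffunE; case: (eqVneq h' h2) => [<- /eqP|_ /eqP]; last by rewrite (negbTE ne).
    rewrite setD_eq0 subset1 (negbTE ne) orbF => e.
    by constructor 1; rewrite e setU11.
  have [->|ne] := eqVneq h' h; first by constructor 3.
  by case: (PU h' h'D h'0) => [h'U|]; [constructor 1; rewrite !inE ne|constructor 2].
move=> QF h' h'D h'0; case: (QF h' h'D h'0) => [||->]; [by left|by right|right].
by move=> a h'' hb; apply: visits_remove; rewrite eq_l inE.
Qed.

End WorklistTheory.

(** * Safety conditions on histories *)

Lemma take_mkseq (T : Type) (w : nat -> T) m n : m <= n -> take m (mkseq w n) = mkseq w m.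
Proof. by move=> le; rewrite /mkseq -map_take take_iota (minn_idPl le). Qed.

Lemma mkseqS (T : Type) (w : nat -> T) n : mkseq w n.+1 = rcons (mkseq w n) (w n).
Proof. by rewrite /mkseq -addn1 iotaD map_cat cats1. Qed.

Lemma onth_some (T : Type) (x0 : T) s n : n < size s -> onth s n = Some (nth x0 s n).
Proof. by move=> lt; rewrite onthE (nth_map x0). Qed.

Section SafetyGames.
Variables (R : realType) (d : nat) (G : arena R d).
Local Notation S := (states G).
Local Notation A := (actions G).
Implicit Types (h : seq S) (xi D : strategy G) (Z : seq S -> Prop).

Definition move xi h s := exists2 a, a \in xi h & s \in trans (last (init G) h) a.

Lemma consistent_fromP i xi h : 0 < i ->
  consistent_from i xi (Fin h) <->
  forall t, i <= t < size h -> move xi (take t h) (nth (init G) h t).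
Proof.
move=> i0; split=> [con t /andP [it th]|con t s s' it /=].
  have t0 := leq_trans i0 it.
  rewrite /move (last_nth (init G)) size_takel ?(ltnW th) //.
  have -> : nth (init G) (init G :: take t h) t = nth (init G) h t.-1.
    by case: t t0 {it th} => // t _; rewrite /= nth_take.
  by apply: (con t) => //=; apply: onth_some => //; rewrite prednK // ltnW.
have t0 := leq_trans i0 it.
move=> ts ts'.
have th : t < size h by rewrite -onthTE ts'.
move: ts ts'; rewrite !(onth_some (init G)) ?prednK // 1?ltnW // => -[<-] [<-].
have := con t; rewrite it th => /(_ isT).
rewrite /move (last_nth (init G)) size_takel ?(ltnW th) //.
by case: t t0 {it th} => // t _; rewrite /= nth_take.
Qed.

Lemma consistent_from_InfP i xi (w : nat -> S) : 0 < i ->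
  consistent_from i xi (Inf w) <-> forall t, i <= t -> move xi (mkseq w t) (w t).
Proof.
move=> i0.
have lastw t : i <= t -> last (init G) (mkseq w t) = w t.-1.
  by case: t => [|t _]; [rewrite leqNgt i0|rewrite mkseqS last_rcons].
split=> [con t it|con t s s' it [<-] [<-]].
  by rewrite /move lastw //; apply: (con t).
by have := con t it; rewrite /move lastw.
Qed.

Lemma consistent_from_mkseq i xi (w : nat -> S) : 0 < i ->
  consistent_from i xi (Inf w) <-> forall n, consistent_from i xi (Fin (mkseq w n)).
Proof.
move=> i0; split=> [/(consistent_from_InfP _ _ i0) con n|con].
  apply/(consistent_fromP _ _ i0) => t; rewrite size_mkseq => /andP [it tn].
  by rewrite take_mkseq ?(ltnW tn) // nth_mkseq //; apply: con.
apply/(consistent_from_InfP _ _ i0) => t it.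
have /(consistent_fromP _ _ i0) := con t.+1; move=> /(_ t).
by rewrite size_mkseq it ltnSn take_mkseq // nth_mkseq //; apply.
Qed.

Lemma consistent_from_rcons i xi h s : 0 < i ->
  consistent_from i xi (Fin (rcons h s)) <->
  consistent_from i xi (Fin h) /\ (i <= size h -> move xi h s).
Proof.
move=> i0; split=> [/(consistent_fromP _ _ i0) con|[/(consistent_fromP _ _ i0) con mv]].
  split=> [|ih].
    apply/(consistent_fromP _ _ i0) => t /andP [it th]; have := con t.
    rewrite it size_rcons ltnS (ltnW th) => /(_ isT).
    by rewrite -cats1 takel_cat ?(ltnW th) // nth_cat th.
  have := con (size h); rewrite ih size_rcons ltnSn => /(_ isT).
  by rewrite -cats1 take_size_cat // nth_cat ltnn subnn.
apply/(consistent_fromP _ _ i0) => t; rewrite size_rcons ltnS => /andP [it].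
rewrite leq_eqVlt => /orP [/eqP eqt|th].
  by rewrite eqt -cats1 take_size_cat // nth_cat ltnn subnn /=; apply: mv; rewrite -eqt.
by rewrite -cats1 takel_cat ?(ltnW th) // nth_cat th; apply: con; rewrite it.
Qed.

Lemma extend_history Z h :
    (forall h, Z h -> exists s, Z (rcons h s)) -> Z h ->
  exists w, mkseq w (size h) = h /\ forall t, size h <= t -> Z (mkseq w t).
Proof.
move=> ext Zh.
have /boolp.choice [g Zg] h' : exists s, Z h' -> Z (rcons h' s).
  by have [/ext [s]|nZ] := pselect (Z h'); [exists s|exists (init G) => /nZ].
pose hist n := iter n (fun h => rcons h (g h)) h.
have size_hist n : size (hist n) = size h + n.
  by elim: n => [|n IHn]; rewrite ?addn0 //= size_rcons IHn addnS.
have nth_hist m n j : j < size h + m -> j < size h + n ->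
    nth (init G) (hist m) j = nth (init G) (hist n) j.
  wlog le_mn : m n / m <= n => [hw jm jn|jm _].
    by case/orP: (leq_total m n) => le; [|symmetry]; apply: hw.
  rewrite -(subnKC le_mn); elim: (n - m) => [|p IHp]; first by rewrite addn0.
  rewrite addnS /= nth_rcons size_hist IHp addnA.
  by rewrite (leq_trans jm) // leq_addr.
pose w j := nth (init G) (hist j.+1) j.
have mkw t : size h <= t -> mkseq w t = hist (t - size h).
  move=> le; apply: (@eq_from_nth _ (init G)) => [|j]; rewrite size_mkseq.
    by rewrite size_hist subnKC.
  by move=> jt; rewrite nth_mkseq //; apply: nth_hist; rewrite ?subnKC // addnS ltnS leq_addl.
exists w; split=> [|t le]; first by rewrite mkw // subnn.
by rewrite mkw //; elim: (t - size h) => //= n /Zg.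
Qed.

(* The greatest fixed point, as the union of all post-fixed points [Z]. *)
Definition safe (ok : seq S -> bool) h : Prop :=
  exists2 Z : seq S -> Prop, Z h &
    forall h, Z h -> ok h /\
      exists a, forall s, s \in trans (last (init G) h) a -> Z (rcons h s).

Definition sigma ok : strategy G := fun h =>
  [set a | `[< forall s, s \in trans (last (init G) h) a -> safe ok (rcons h s) >]].

Lemma safe_sub (ok ok' : seq S -> bool) n h :
    (forall h, n <= size h -> ok h -> ok' h) -> n <= size h ->
  safe ok h -> safe ok' h.
Proof.
move=> sub nh [Z Zh ZP]; exists (fun h => n <= size h /\ Z h) => //.
move=> h' [nh' /ZP [okh [a ah]]]; split; first exact: sub.
by exists a => s /ah; rewrite size_rcons leqW.
Qed.

Section SafetyCondition.
Variable ok : seq S -> bool.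

Lemma sigmaP a h : reflect
  (forall s, s \in trans (last (init G) h) a -> safe ok (rcons h s)) (a \in sigma ok h).
Proof. by rewrite inE; apply: asboolP. Qed.

Lemma safeP h : safe ok h <-> ok h /\ sigma ok h != set0.
Proof.
split=> [[Z Zh ZP]|[okh /set0Pn [a /sigmaP ah]]].
  have [okh [a ah]] := ZP h Zh; split=> //; apply/set0Pn; exists a.
  by apply/sigmaP => s /ah Zs; exists Z.
exists (fun h' => h' = h \/ safe ok h'); first by left.
move=> h' [->|[Z Zh' ZP]]; first by split=> //; exists a => s /ah; right.
have [okh' [b bh]] := ZP _ Zh'; split=> //; exists b => s /bh Zs.
by right; exists Z.
Qed.

Lemma safe_ok h : safe ok h -> ok h.
Proof. by case/safeP. Qed.

Lemma exists_move xi h : xi h != set0 -> exists s, move xi h s.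
Proof.
case/set0Pn=> a ah; have /set0Pn [s sa] := trans_neq0 (last (init G) h) a.
by exists s; exists a.
Qed.

Definition reach xi h := ohead h = Some (init G) /\ consistent xi (Fin h).

Lemma reach_init xi : reach xi [:: init G].
Proof. by split=> //; apply/consistent_fromP => // -[|[]]. Qed.

Lemma reach_rcons xi h s : reach xi h -> move xi h s -> reach xi (rcons h s).
Proof.
by move=> [h0 con] mv; split; [case: h h0 {con mv}|apply/consistent_from_rcons].
Qed.

Lemma reach_ind xi (P : seq S -> Prop) : P [:: init G] ->
    (forall h s, reach xi h -> P h -> move xi h s -> P (rcons h s)) ->
  forall h, reach xi h -> P h.
Proof.
move=> P0 PS; elim/last_ind=> [[]//|h s IHh] [].
have [->|h0 hs] := eqVneq h [::]; first by case=> ->.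
move=> /(consistent_from_rcons _ _ _ (ltn0Sn 0)) [con mv].
have rh : reach xi h by split=> //; case: h hs h0 {IHh con mv}.
by apply: PS => //; [exact: IHh|apply: mv; case: h h0 {IHh hs con rh}].
Qed.

Lemma reach_mkseq xi (w : nat -> S) : w 0 = init G ->
  consistent xi (Inf w) <-> forall n, reach xi (mkseq w n.+1).
Proof.
move=> w0; split=> [/consistent_from_mkseq con n|con].
  by split; [rewrite /= w0|apply: con].
apply/(consistent_from_mkseq _ _ (ltn0Sn 0)) => -[|n]; last by case: (con n).
by apply/(consistent_fromP _ _ (ltn0Sn 0)) => t /andP [].
Qed.

Lemma consistent_path xi (w : nat -> S) : consistent xi (Inf w) -> path_of w.
Proof.
move=> /(consistent_from_InfP _ _ (ltn0Sn 0)) con n.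
by have [//|a _] := con n.+1; rewrite mkseqS last_rcons; exists a.
Qed.

Lemma extend_play xi h : (forall h, reach xi h -> xi h != set0) -> reach xi h ->
  exists w, [/\ w 0 = init G, mkseq w (size h) = h & consistent xi (Inf w)].
Proof.
move=> ne rh; have [|w [wh rw]] := extend_history _ rh.
  by move=> h' rh'; have [s mv] := exists_move (ne _ rh'); exists s; apply: reach_rcons.
have w0 : w 0 = init G.
  by case: h wh {rw} rh => [|s h] /= => [_ [] //|[->] _ [[]]].
exists w; split=> //; apply/(reach_mkseq _ w0) => n.
have := leq_total (size h) n.+1 => /orP [/rw //|le]; split; first by rewrite /= w0.
have [_ con] := rh; apply/consistent_fromP => // t.
rewrite size_mkseq => /andP [t0 tn]; have := proj1 (consistent_fromP _ _ _) con t.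
have th := leq_trans tn le; rewrite t0 th => /(_ (ltn0Sn 0) isT).
by rewrite -wh take_mkseq ?(ltnW th) // !nth_mkseq // take_mkseq // ltnW.
Qed.

Variable F : (nat -> S) -> Prop.
Hypothesis FP : forall w, F w <-> forall n, ok (mkseq w n.+1).

Lemma winning_safe xi h : winning F xi -> reach xi h -> safe ok h.
Proof.
move=> [ne win] rh; exists (reach xi) => // h' rh'.
have ne' h1 : reach xi h1 -> xi h1 != set0 by case; apply: ne.
split; last first.
  by have /set0Pn [a ah] := ne' _ rh'; exists a => s sa; apply: reach_rcons => //; exists a.
have [w [w0 wh' con]] := extend_play ne' rh'.
have /FP okw := win w w0 (consistent_path con) con.
by move: rh' wh' => [+ _]; case: (h') => // s h1 _ <-; apply: okw.
Qed.

Lemma winning_sub_sigma xi h : winning F xi -> reach xi h -> xi h \subset sigma ok h.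
Proof.
move=> wx rh; apply/fintype.subsetP => a ah; apply/sigmaP => s sa.
by apply: (winning_safe wx); apply: reach_rcons => //; exists a.
Qed.

Lemma reach_sigma_safe h : (exists xi, winning F xi) -> reach (sigma ok) h -> safe ok h.
Proof.
move=> [xi wx]; apply: reach_ind => [|h' s _ _ [a /sigmaP]]; last by apply.
exact/(winning_safe wx)/reach_init.
Qed.

(* The moves are compared, not the action sets: subsumption only sees the plays. *)
Definition agrees D h :=
  D h \subset sigma ok h /\ forall s, move (sigma ok) h s -> move D h s.

Lemma agrees_eq D h : D h = sigma ok h -> agrees D h.
Proof. by rewrite /agrees /move => ->. Qed.

Lemma agrees_reach D h : (forall h, reach (sigma ok) h -> agrees D h) ->
  reach D h <-> reach (sigma ok) h.
Proof.
move=> agr; split; apply: reach_ind; try exact: reach_init.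
  move=> h' s _ rh' [a aD sa]; apply: reach_rcons => //; exists a => //.
  by have [/fintype.subsetP sub _] := agr _ rh'; apply: sub.
by move=> h' s rh' rD mv; apply: reach_rcons => //; have [_] := agr _ rh'; apply.
Qed.

Lemma agrees_max_permissive D : (exists xi, winning F xi) ->
  (forall h, reach (sigma ok) h -> agrees D h) -> max_permissive F D.
Proof.
move=> wF agr; split; first split.
- move=> h h0 con; have /(agrees_reach _ agr) rh : reach D h by [].
  have /safeP [_ /exists_move [s mv]] := reach_sigma_safe wF rh.
  by have [_ /(_ s mv) [a aD _]] := agr _ rh; apply/set0Pn; exists a.
- move=> w w0 _ /(reach_mkseq _ w0) con; apply/FP => n; apply: safe_ok.
  exact/(reach_sigma_safe wF)/(agrees_reach _ agr).
- move=> xi wx w w0 _ con; apply/(reach_mkseq _ w0) => n; apply/(agrees_reach _ agr).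
  move/(reach_mkseq _ w0) in con.
  elim: n => [|n IHn]; first by rewrite /mkseq /= w0; apply: reach_init.
  rewrite mkseqS; apply: reach_rcons => //.
  have [_ /(consistent_fromP _ _ (ltn0Sn 0)) /(_ n.+1)] := con n.+1.
  rewrite size_mkseq ltnSn take_mkseq // nth_mkseq // => /(_ isT) [a ax sa].
  exists a => //; exact: (fintype.subsetP (winning_sub_sigma wx (con n))).
Qed.

Lemma max_permissive_agrees xi h : max_permissive F xi -> reach (sigma ok) h -> agrees xi h.
Proof.
move=> [wx sub] rh; have wF : exists xi, winning F xi by exists xi.
have [ws _] := agrees_max_permissive wF (fun h _ => agrees_eq (erefl (sigma ok h))).
have rx h' : reach (sigma ok) h' -> reach xi h'.
  move=> rh'; have ne h1 : reach (sigma ok) h1 -> sigma ok h1 != set0.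
    by move=> /(reach_sigma_safe wF) /safeP [].
  have [w [w0 wh' con]] := extend_play ne rh'.
  have /(reach_mkseq _ w0) := sub _ ws w w0 (consistent_path con) con.
  by move: rh' wh' => [+ _]; case: (h') => // s h1 _ <-; apply.
split=> [|s mv]; first exact: (winning_sub_sigma wx (rx _ rh)).
have [_ /(consistent_from_rcons _ _ _ (ltn0Sn 0)) [_]] := rx _ (reach_rcons rh mv).
by apply; case: rh => + _; case: (h).
Qed.

End SafetyCondition.
End SafetyGames.

(** * Windows *)

Section Locality.
Variables (R : realType) (d : nat) (dtau : R) (S : {fset 'rV[R]_d}).
Implicit Types (phi : dsp R d) (w : word S) (h : seq S).

Lemma deriv_local k w w' t t' :
    (forall j, j <= k -> letter w (t - j) = letter w' (t' - j)) ->
  Defs.deriv dtau k w t = Defs.deriv dtau k w' t'.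
Proof.
elim: k t t' => [|k IHk] t t' eq_l /=; first by have := eq_l 0 isT; rewrite !subn0.
rewrite (IHk t t') => [|j jk]; last by apply: eq_l; apply: leqW.
rewrite (IHk t.-1 t'.-1) // => j jk.
by rewrite -!subn1 -!subnDA !add1n; apply: eq_l.
Qed.

Lemma sat_local phi w w' t t' :
    (forall j, j <= ord phi -> letter w (t - j) = letter w' (t' - j)) ->
  sat dtau phi t w = sat dtau phi t' w'.
Proof.
elim: phi => [k Z|phi1 IH1 phi2 IH2|phi1 IH1] /= eq_l.
- by rewrite (deriv_local eq_l).
- by rewrite IH1 ?IH2 // => j le; apply: eq_l; rewrite leq_max le ?orbT.
- by rewrite IH1.
Qed.

Definition satw phi h := sat dtau phi (size h) (Fin h).

Lemma sat_mkseq phi (w : nat -> S) t : ord phi < t ->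
  sat dtau phi t (Inf w) = satw phi (mkseq w t).
Proof.
move=> lt; apply: sat_local => j le; rewrite size_mkseq /letter /=.
rewrite (onth_some (w 0)) ?size_mkseq ?nth_mkseq //; lia.
Qed.

Lemma satw_drop phi n h : ord phi < size (drop n h) ->
  satw phi (drop n h) = satw phi h.
Proof.
rewrite size_drop => lt; apply: sat_local => j le; rewrite /letter /=.
rewrite size_drop !onthE map_drop nth_drop.
by congr (if nth _ _ _ is Some s then _ else _); lia.
Qed.

End Locality.

Section Windows.
Variables (R : realType) (d : nat) (G : arena R d) (dtau : R).
Local Notation S := (states G).
Local Notation A := (actions G).
Implicit Types (phi : dsp R d) (h : seq S).

Definition window_ok phi i h := (i <= size h) ==> satw dtau phi h.

Lemma consistent_from_take i xi h n : 0 < i ->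
  consistent_from i xi (Fin h) -> consistent_from (G := G) i xi (Fin (take n h)).
Proof.
move=> i0 /(consistent_fromP _ _ i0) con; apply/(consistent_fromP _ _ i0) => t.
rewrite size_take_min leq_min => /and3P [it tn th].
by rewrite take_takel ?(ltnW tn) // nth_take //; apply: con; rewrite it.
Qed.

Lemma last_drop (T : Type) (x : T) (s : seq T) n : n < size s -> last x (drop n s) = last x s.
Proof.
move=> lt; rewrite -{2}(cat_take_drop n s) last_cat.
by case e : (drop n s) => //; move: (size_drop n s); rewrite e /=; lia.
Qed.

Section Level.
Variables (phi : dsp R d) (i : nat).
Hypothesis phi_i : ord phi < i.
Local Notation safe := (@safe R d G (window_ok phi i)) (only parsing).

Lemma safe_drop n h : n < size h -> safe h -> safe (drop n h).
Proof.
move=> lt sh.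
exists (fun h' => exists n h, [/\ n < size h, h' = drop n h & safe h]); first by exists n, h.
move=> _ {n h lt sh} [n [h [lt -> sh]]].
have [okh' /set0Pn [a /sigmaP ah]] := proj1 (safeP _ _) sh; split.
  apply/implyP => le; rewrite satw_drop ?(leq_trans phi_i) //.
  by apply: (implyP okh'); rewrite (leq_trans le) // size_drop leq_subr.
exists a => s; rewrite last_drop // => /ah srs.
by exists n, (rcons h s); rewrite size_rcons ltnS drop_rcons ltnW.
Qed.

Lemma safe_window_drop n h : i <= size (drop n h) -> safe (drop n h) <-> safe h.
Proof.
move=> le; split=> [sh|]; last first.
  by apply: safe_drop; rewrite -subn_gt0 -size_drop; apply: leq_trans le; apply: leq_trans phi_i.
exists (fun h => i <= size (drop n h) /\ safe (drop n h)); first by [].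
move=> {le sh}h [le sh]; have [okh /set0Pn [a /sigmaP ah]] := proj1 (safeP _ _) sh.
have lt : n < size h.
  by rewrite -subn_gt0 -size_drop; apply: leq_trans le; apply: leq_trans phi_i.
split.
  by move: okh; rewrite /window_ok satw_drop ?(leq_trans phi_i) // le => /= ->; rewrite implybT.
exists a => s; rewrite -(last_drop _ lt) => /ah; rewrite drop_rcons ?(ltnW lt) // => srs.
by split=> //; rewrite size_rcons; apply: leqW.
Qed.

Lemma sigma_window_drop n h : n < size h -> i <= (size (drop n h)).+1 ->
  sigma (G := G) (window_ok phi i) (drop n h) = sigma (G := G) (window_ok phi i) h.
Proof.
move=> lt le; have eqv s : safe (rcons (drop n h) s) <-> safe (rcons h s).
  rewrite -drop_rcons ?(ltnW lt) //; apply: safe_window_drop.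
  by rewrite drop_rcons ?size_rcons // ltnW.
apply/setP => a; apply/sigmaP/sigmaP => ah s.
  by rewrite -(last_drop _ lt) => /ah /eqv.
by rewrite last_drop // => /ah /eqv.
Qed.

Lemma winning_windowP (s : i.-tuple S) : winning_window dtau phi s <-> safe s.
Proof.
have i0 : 0 < i by apply: leq_trans phi_i.
split=> [[xi [ne win]]|ss].
  pose Z h := take i h = s /\ consistent_from i xi (Fin h); exists Z.
    split; first by rewrite take_oversize ?size_tuple.
    by apply/(consistent_fromP _ _ i0) => t; rewrite size_tuple => /andP [/leq_gtF ->].
  move=> h [hs con]; have ih : i <= size h.
    by have := size_tuple s; rewrite -hs size_take_min => /minn_idPl.
  have ext h' s' : move xi h' s' -> take i h' = s /\ consistent_from i xi (Fin h') ->
      take i (rcons h' s') = s /\ consistent_from i xi (Fin (rcons h' s')).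
    move=> mv [hs' con']; split; last exact/(consistent_from_rcons _ _ _ i0).
    rewrite -cats1 takel_cat //.
    by have := size_tuple s; rewrite -hs' size_take_min => /minn_idPl.
  split; last first.
    by have /set0Pn [a ah] := ne h; exists a => s' sa; apply: ext => //; exists a.
  apply/implyP => _.
  have [|w [wh cw]] := extend_history (G := G) (Z := Z) _ (conj hs con).
    by move=> h' Zh'; have [s' mv] := exists_move (ne h'); exists s'; apply: ext.
  rewrite -{1}wh -sat_mkseq ?(leq_trans phi_i) //; apply: win => //.
    by rewrite /= -hs -{1}wh take_mkseq.
  apply/(consistent_from_mkseq _ _ i0) => n.
  have [_] := cw (maxn n (size h)) (leq_maxr _ _).
  by move=> /(consistent_from_take (n := n) i0); rewrite take_mkseq ?leq_maxl.
pose sg := sigma (G := G) (window_ok phi i).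
exists (fun h => if sg h == set0 then setT else sg h); split=> [h|w ws con t].
  by case: ifP => [_|->//]; rewrite -card_gt0 cardsT actions_neq0.
move=> it; suff /safe_ok : safe (mkseq w t).
  by rewrite /window_ok size_mkseq it -sat_mkseq ?(leq_trans phi_i).
rewrite -(subnKC it); elim: (t - i) => [|n IHn]; first by rewrite addn0 [mkseq _ _]ws.
move/(consistent_from_InfP _ _ i0) in con.
rewrite addnS mkseqS; have [a + sa] := con (i + n) (leq_addr _ _).
have [_ /negbTE ->] := proj1 (safeP _ _) IHn.
by move/sigmaP; apply.
Qed.

End Level.

Lemma behead_rcons_shift i (s : i.+1.-tuple S) s' : shift s s' = drop 1 (rcons s s') :> seq S.
Proof. by case: s => -[|x s]//= _; rewrite drop0. Qed.

Lemma tlastE i (s : i.+1.-tuple S) x : tlast s = last x s.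
Proof. by rewrite /tlast (tnth_nth x) (last_nth x) size_tuple; case: s => -[]. Qed.

Lemma safe_shift phi i (s : i.+1.-tuple S) s' : ord phi < i.+1 ->
  safe (G := G) (window_ok phi i.+1) (shift s s') <->
  safe (G := G) (window_ok phi i.+1) (rcons s s').
Proof.
move=> phi_i; rewrite behead_rcons_shift; apply: safe_window_drop => //.
by rewrite size_drop size_rcons size_tuple subn1.
Qed.

Lemma safe_windows phi i (W : {set i.+1.-tuple S}) : ord phi < i.+1 ->
    (forall s, s \in W -> sat dtau phi i.+1 (Fin s) /\
       exists a, forall s', s' \in trans (tlast s) a -> shift s s' \in W) ->
  forall s, s \in W -> safe (G := G) (window_ok phi i.+1) s.
Proof.
move=> phi_i WP s sW.
exists (fun h => exists n s, s \in W /\ drop n h = s); first by exists 0, s; rewrite drop0.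
move=> h {s sW} [n [s [sW hs]]]; have [okh [a ah]] := WP s sW.
have lt : n < size h by rewrite -subn_gt0 -size_drop hs size_tuple.
split.
  by rewrite /window_ok -(satw_drop _ (n := n)) hs ?size_tuple // /satw size_tuple okh implybT.
exists a => s'; rewrite -(last_drop _ lt) hs -tlastE => /ah sW'.
exists n.+1, (shift s s'); split=> //.
by rewrite behead_rcons_shift -hs -drop_rcons ?(ltnW lt) // drop_drop add1n.
Qed.

Lemma shift_surj i (s s' : i.+1.-tuple S) : behead s' = take i s -> s = shift s' (tlast s).
Proof.
move=> e; apply: val_inj; rewrite /= e.
rewrite /tlast (tnth_nth (init G)) /= -take_nth ?size_tuple //.
by rewrite take_oversize ?size_tuple.
Qed.

Lemma behead_shift i (s : i.+1.-tuple S) s' : behead s = take i (shift s s').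
Proof. by rewrite /= -cats1 take_size_cat // size_behead size_tuple. Qed.

Lemma tlast_shift i (s : i.+1.-tuple S) s' : tlast (shift s s') = s'.
Proof. by rewrite (tlastE _ (init G)) /= last_rcons. Qed.

End Windows.

(** * Iterative synthesis *)

Section IterativeSynthesis.
Variables (R : realType) (d : nat) (G : arena R d) (dtau : R).
Variables (k : nat) (phi : nat -> dsp R d).
Local Notation S := (states G).
Local Notation A := (actions G).
Implicit Types (h : seq S) (o : synthesis G).

Lemma iterative_synthesis_exists : exists o : synthesis G, iterative_synthesis dtau k phi o.
Proof.
pose level i := ({set i.-tuple S} * {ffun i.-tuple S -> {set A}} * nat)%type.
have next i (l : level i) : {l' : level i.+1 |
    let C := candidates dtau phi l.1.1 in
    let xi0 := iter_init l.1.2 C in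
    wl_run (iter_back C) ([set s in C | xi0 s == set0], xi0) l'.1.2 l'.2 /\
    l'.1.1 = [set s in C | l'.1.2 s != set0]}.
  apply: cid; pose C := candidates dtau phi l.1.1; pose xi0 := iter_init l.1.2 C.
  have [xi [n run]] := wl_run_exists (iter_back C) ([set s in C | xi0 s == set0], xi0).
  by exists ([set s in C | xi s != set0], xi, n).
pose fix lev i : level i :=
  if i is j.+1 return level i then sval (next j (lev j))
  else (setT, [ffun=> setT], 0).
pose fix hats n i {struct n} : {ffun i.-tuple S -> {set A}} :=
  if n is n'.+1 then
    if i is j.+1 return {ffun i.-tuple S -> {set A}} then hat_step dtau phi (hats n' j.+2)
    else [ffun=> setT]
  else (lev i).1.2.
exists (Synthesis (fun i => (lev i).1.1)
  (fun i => if i is j.+1 then candidates dtau phi (lev j).1.1 else set0)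
  (fun i => (lev i).1.2) (fun i => hats (k - i) i) (fun i => (lev i).2)).
split=> //= [i ik||i ik]; last by rewrite -subnSK.
  by case: (next i (lev i)) => /= l [].
by rewrite subnn.
Qed.

(* Level 0 is the trivial condition, as [win o 0] and [act o 0] are full. *)
Definition level_ok i h := if i is 0 then true else window_ok dtau (phi i) i h.

Hypothesis hier : hierarchical dtau S k phi.

Lemma ord_level i : 0 < i <= k -> ord (phi i) < i.
Proof. by move=> ik; rewrite (proj1 hier) // prednK //; case/andP: ik. Qed.

Lemma level_ok_pred i h : i < k -> i < size h -> level_ok i.+1 h -> level_ok i h.
Proof.
case: i => // i ik lt; rewrite /level_ok /window_ok (ltnW lt) lt /=.
have oS : ord (phi i.+2) < i.+2 by apply: ord_level.
have o1 : ord (phi i.+1) < i.+1 by apply: ord_level; rewrite (ltnW ik).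
pose n := size h - i.+2.
have szn : size (drop n h) == i.+2 by rewrite size_drop subKn.
have sz1 : size (drop n.+1 h) = i.+1 by rewrite size_drop; lia.
rewrite -(satw_drop dtau (n := n)) ?(eqP szn) //
  -(satw_drop dtau (n := n.+1) (phi := phi i.+1)) ?sz1 //.
have := proj2 hier i.+2; rewrite ltnS ltn0Sn ik => /(_ isT) /(_ (Tuple szn)) /=.
by rewrite -drop1 drop_drop add1n /satw (eqP szn) sz1.
Qed.

Lemma safe_level_pred i h : i < k -> i < size h ->
  safe (G := G) (level_ok i.+1) h -> safe (G := G) (level_ok i) h.
Proof.
move=> ik; apply: safe_sub => h'; exact: level_ok_pred.
Qed.

Lemma safe_level0 i h : i = 0 -> safe (G := G) (level_ok i) h.
Proof.
move->.
have /card_gt0P [a _] := actions_neq0 G.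
by exists (fun=> True) => // h' _; split=> //; exists a.
Qed.

Lemma safe_level_behead i (s : i.+1.-tuple S) : i < k ->
  safe (G := G) (level_ok i.+1) s -> safe (G := G) (level_ok i) (behead s).
Proof.
move=> ik ss; case: i s ik ss => [|i] s ik ss; first exact: safe_level0.
rewrite -drop1; apply: safe_drop; rewrite ?size_tuple //.
  by apply: ord_level; rewrite (ltnW ik).
by apply: (safe_level_pred (i := i.+1)); rewrite ?size_tuple.
Qed.

Variable o : synthesis G.
Hypothesis io : iterative_synthesis dtau k phi o.

Lemma act_notin_cand i (s : i.+1.-tuple S) : i < k -> s \notin cand o i.+1 -> act o i.+1 s = set0.
Proof.
case: io => _ levels _ _ /levels [_ run _] nC; apply/eqP; rewrite -subset0.
by have := wl_run_sub s run; rewrite /= ffunE (negbTE nC).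
Qed.

Lemma winE i (s : i.+1.-tuple S) : i < k -> (s \in win o i.+1) = (act o i.+1 s != set0).
Proof.
move=> ik; case: io => _ /(_ i ik) [_ _ ->] _ _; rewrite inE.
by have [//|/(act_notin_cand ik) ->] := boolP (s \in cand o i.+1); rewrite eqxx.
Qed.

Lemma synthesis_levels i (s : i.-tuple S) : i <= k ->
  (s \in win o i <-> safe (G := G) (level_ok i) s) /\
  (safe (G := G) (level_ok i) s -> act o i s = sigma (G := G) (level_ok i) s).
Proof.
elim: i s => [|i IHi] s ik.
  case: io => -[-> ->] _ _ _; split; first by rewrite inE; split=> // _; apply: safe_level0.
  move=> _; rewrite ffunE; apply/setP => a; rewrite in_setT; symmetry.
  by apply/sigmaP => s' _; apply: safe_level0.
have oi : ord (phi i.+1) < i.+1 by apply: ord_level.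
have shiftP (u : i.+1.-tuple S) s' := safe_shift dtau u s' oi.
case: (io) => _ /(_ i ik) [defC run defW] _ _.
set C := cand o i.+1 in defC run defW.
set xi := act o i.+1 in run defW *.
have inC (u : i.+1.-tuple S) : safe (G := G) (level_ok i.+1) u -> u \in C.
  move=> su; rewrite defC inE; apply/andP; split.
    by have := safe_ok su; rewrite /level_ok /window_ok size_tuple leqnn /satw size_tuple.
  by apply/(proj1 (IHi [tuple of behead u] (ltnW ik)))/safe_level_behead.
have sub_xi : forall u : i.+1.-tuple S, [set a in sigma (G := G) (level_ok i.+1) u |
    `[< safe (G := G) (level_ok i.+1) u >]] \subset xi u.
  apply: (wl_run_max (eta := fun u : i.+1.-tuple S => [set a in sigma (G := G) (level_ok i.+1) u |
    `[< safe (G := G) (level_ok i.+1) u >]]) _ run).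
  - by move=> u; rewrite /= inE => /andP [_ /eqP].
  - move=> u; apply/fintype.subsetP => a; rewrite inE => /andP [/sigmaP au /asboolP su].
    have sh s' : s' \in trans (tlast u) a -> safe (G := G) (level_ok i.+1) (shift u s').
      by rewrite (tlastE _ (init G)) => /au srs; apply/shiftP.
    rewrite ffunE inC // inE; apply/andP; split; last first.
      by apply/forall_inP => s' /sh; apply: inC.
    rewrite (proj2 (IHi [tuple of behead u] (ltnW ik))); last exact: safe_level_behead.
    apply/sigmaP => s'; have [i0|i0] := posnP i; first by move=> _; apply: safe_level0.
    have lu : last (init G) (behead u) = tlast u.
      by rewrite (tlastE _ (init G)) -drop1 last_drop ?size_tuple.
    rewrite lu => /sh; rewrite -[rcons _ _]/(val (shift u s')).
    by apply: safe_level_pred; rewrite // size_tuple.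
  - move=> u u' a; rewrite inE => /andP [/sigmaP au /asboolP su].
    rewrite inE => /and3P [uC /eqP /shift_surj eu sa].
    have su' : safe (G := G) (level_ok i.+1) u'.
      by rewrite eu; apply/shiftP/au; rewrite -tlastE.
    have [_ /set0Pn [b bu']] := proj1 (safeP _ _) su'.
    by apply/set0Pn; exists b; rewrite inE bu'; apply/asboolP.
have xi_shift (u : i.+1.-tuple S) a s' : u \in C -> a \in xi u -> s' \in trans (tlast u) a ->
    shift u s' \in win o i.+1.
  move=> uC au sa; have := fintype.subsetP (wl_run_sub u run) _ au.
  rewrite /= ffunE uC inE => /andP [_ /forall_inP /(_ s' sa) sC].
  rewrite defW inE sC; apply: (wl_run_closed (D := C) _ run _ _ au) => //.
    by move=> v vC v0; rewrite inE vC; apply/eqP.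
  by rewrite inE uC -behead_shift tlast_shift eqxx.
have win_safe : forall u : i.+1.-tuple S, u \in win o i.+1 -> safe (G := G) (level_ok i.+1) u.
  apply: safe_windows => // u; rewrite {1}defW inE => /andP [uC /set0Pn [a au]]; split.
    by move: uC; rewrite defC inE => /andP [].
  by exists a => s'; apply: xi_shift.
have act_safe (u : i.+1.-tuple S) :
    safe (G := G) (level_ok i.+1) u -> xi u = sigma (G := G) (level_ok i.+1) u.
  move=> su; apply/eqP; rewrite eqEsubset; apply/andP; split; apply/fintype.subsetP => a au.
    apply/sigmaP => s'; rewrite -tlastE => sa; apply/shiftP/win_safe.
    exact: xi_shift (inC _ su) au sa.
  by apply: (fintype.subsetP (sub_xi u)); rewrite inE au; apply/asboolP.
split; last exact: act_safe.
split; first exact: win_safe.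
move=> ss; rewrite winE // act_safe //.
by have [] := proj1 (safeP _ _) ss.
Qed.

Lemma act_neq0 i (s : i.+1.-tuple S) : i < k ->
  act o i.+1 s != set0 <-> safe (G := G) (level_ok i.+1) s.
Proof. by move=> ik; rewrite -winE //; exact: (synthesis_levels s ik).1. Qed.

Lemma safe_in_cand i (s : i.+1.-tuple S) : i < k ->
  safe (G := G) (level_ok i.+1) s -> s \in cand o i.+1.
Proof. by move=> ik /(act_neq0 s ik); apply: contraR => /(act_notin_cand ik) ->. Qed.

Lemma act_stored i (s : i.-tuple S) : 0 < i <= k ->
  act o i s != set0 <-> safe (G := G) (level_ok i) s.
Proof. by case: i s => // i s ik; apply: act_neq0. Qed.

Lemma winning_windowsP i (s : i.+1.-tuple S) : i < k ->
  s \in winning_windows G dtau (phi i.+1) i.+1 <-> safe (G := G) (level_ok i.+1) s.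
Proof.
move=> ik; have wP := winning_windowP (G := G) dtau (ord_level (i := i.+1) ik) s.
by rewrite inE; split=> [/asboolP/wP|/wP/asboolP].
Qed.

Lemma win_act_correct i : i < k ->
  win o i.+1 = winning_windows G dtau (phi i.+1) i.+1 /\
  (forall s, s \in winning_windows G dtau (phi i.+1) i.+1 ->
     act o i.+1 s = safe_actions dtau phi s).
Proof.
move=> ik; split=> [|s /(winning_windowsP s ik) ss].
  apply/setP => s; apply/idP/idP.
    by move=> sw; apply/(winning_windowsP s ik)/(synthesis_levels s ik).1.
  by move=> /(winning_windowsP s ik)/(synthesis_levels s ik).1.
rewrite ((synthesis_levels s ik).2 ss); apply/setP => a; rewrite [RHS]inE.
have shiftP s' := safe_shift dtau s s' (ord_level (i := i.+1) ik).
apply/sigmaP/forall_inP => as' s'.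
  by rewrite (tlastE _ (init G)) => /as' srs; apply/(winning_windowsP _ ik)/shiftP.
by rewrite -tlastE => /as' /(winning_windowsP _ ik) /shiftP.
Qed.

Lemma lookup_tuple i (xi : {ffun i.-tuple S -> {set A}}) (s : i.-tuple S) :
  lookup xi s = xi s.
Proof. by rewrite /lookup valK. Qed.

Hypothesis k_gt0 : 0 < k.

Lemma level_okE i : 0 < i -> level_ok i = window_ok dtau (phi i) i.
Proof. by case: i. Qed.

Lemma lookup_act h : k <= size h -> safe (G := G) (level_ok k) h ->
  lookup (act o k) (drop (size h - k) h) = sigma (G := G) (level_ok k) h.
Proof.
move=> kh sh; have ok := ord_level (i := k); rewrite k_gt0 leqnn in ok.
have szs : size (drop (size h - k) h) == k by rewrite size_drop subKn.
rewrite -[drop _ _]/(val (Tuple szs)) lookup_tuple.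
rewrite (synthesis_levels (Tuple szs) (leqnn k)).2; rewrite level_okE // in sh *.
  by apply: sigma_window_drop; rewrite ?(eqP szs) ?ok //; lia.
by apply/safe_window_drop; rewrite ?(eqP szs) ?ok.
Qed.

Definition hier_ok h := (0 < size h) ==> satw dtau (phi (minn (size h) k)) h.

Lemma F_hierP w : F_hier (G := G) dtau k phi w <-> forall n, hier_ok (mkseq w n.+1).
Proof.
have om n : ord (phi (minn n.+1 k)) < n.+1.
  by apply: leq_trans (geq_minl n.+1 k); apply: ord_level; rewrite geq_minr leq_min k_gt0.
rewrite /hier_ok; split=> [Fw n|okw [|n] // _].
  by rewrite size_mkseq /= -sat_mkseq //; apply: Fw.
by have := okw n; rewrite size_mkseq /= -sat_mkseq.
Qed.

Lemma hier_ok_long h : k <= size h -> hier_ok h = level_ok k h.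
Proof.
move=> kh; rewrite level_okE // /hier_ok /window_ok (minn_idPr kh) kh.
by rewrite (leq_trans k_gt0 kh).
Qed.

Lemma safe_hier_long h : k <= size h ->
  safe (G := G) hier_ok h <-> safe (G := G) (level_ok k) h.
Proof.
by move=> kh; split; apply: safe_sub kh => h' /hier_ok_long ->.
Qed.

(* At time [t >= i] the condition [phi (minn t k)] implies [phi i] by the hierarchy. *)
Lemma safe_hier_level i h : 0 < i <= k -> i <= size h ->
  safe (G := G) hier_ok h -> safe (G := G) (level_ok i) h.
Proof.
move=> /andP [i0 ik]; apply: safe_sub => {}h ih okh.
have down j : i <= j -> j <= minn (size h) k -> level_ok j h -> level_ok i h.
  move=> ij; rewrite -(subnKC ij); elim: (j - i) => [|n IHn]; first by rewrite addn0.
  rewrite addnS => le /(level_ok_pred _ _) okj; apply: IHn; first exact: ltnW.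
  by apply: okj; apply: leq_trans le _; rewrite ?geq_minl ?geq_minr.
apply: (down (minn (size h) k)) => //; first by rewrite leq_min ih.
rewrite level_okE ?leq_min ?k_gt0 ?(leq_trans i0) // /window_ok geq_minl.
by move: okh; rewrite /hier_ok (leq_trans i0 ih).
Qed.

Lemma hat_spec i (s : i.-tuple S) : 0 < i <= k ->
  (hat o i s != set0 <-> safe (G := G) hier_ok s) /\
  (i < k -> safe (G := G) hier_ok s -> hat o i s = sigma (G := G) hier_ok s).
Proof.
move=> /andP []; move: {2}(k - i) (erefl (k - i)) => n.
case: (io) => _ _ hat_k hatS.
elim: n i s => [|n IHn] i s ki i0 ik.
  have ek : i = k by apply/eqP; rewrite eqn_leq ik -subn_eq0 ki.
  subst i; split; last by rewrite ltnn.
  rewrite hat_k act_stored ?k_gt0 ?leqnn //.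
  by rewrite safe_hier_long // size_tuple.
have {}ik : i < k by rewrite -subn_gt0 ki.
case: i s ki i0 ik => // i s ki _ ik.
have okE : hier_ok s = sat dtau (phi i.+1) i.+1 (Fin s).
  by rewrite /hier_ok /satw size_tuple /= (minn_idPl (ltnW ik)).
have IH s' : hat o i.+2 [tuple of rcons s s'] != set0 <-> safe (G := G) hier_ok (rcons s s').
  have ki' : k - i.+2 = n by lia.
  exact: (IHn _ [tuple of rcons s s'] ki' isT ik).1.
have hatE : hat o i.+1 s = if hier_ok s then sigma (G := G) hier_ok s else set0.
  rewrite hatS // ffunE okE; case: ifP => sat_s; apply/setP => a; last by rewrite !inE.
  rewrite [LHS]inE /=.
  apply/forall_inP/sigmaP => as' s'; first by rewrite -tlastE => /as' /IH.
  by rewrite (tlastE _ (init G)) => /as' /IH.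
split=> [|_ /safeP [ok_s _]]; last by rewrite hatE ok_s.
rewrite hatE; split; last by case/safeP => ->.
by case: ifP => [ok_s ne|_ /eqP //]; apply/safeP.
Qed.

Lemma hier_max_permissive : (exists xi : strategy G, winning (@F_hier R d G dtau k phi) xi) ->
  max_permissive (@F_hier R d G dtau k phi) (window_strategy (hat_strategy o) (act o k)).
Proof.
move=> wF; apply: (agrees_max_permissive F_hierP wF) => h rh; apply: agrees_eq.
have sh := reach_sigma_safe F_hierP wF rh; rewrite /window_strategy.
have h0 : 0 < size h by case: rh; case: (h).
case: ltnP => kh.
  have -> : hat_strategy o h = hat o (size h) (in_tuple h).
    exact: (lookup_tuple _ (in_tuple h)).
  by apply: (hat_spec (in_tuple h) _).2 => //; rewrite h0 ltnW.
have eq_safe h' : k <= size h' -> safe (G := G) hier_ok h' <-> safe (G := G) (level_ok k) h'.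
  exact: safe_hier_long.
rewrite lookup_act //; last exact/eq_safe.
by apply/setP => a; apply/sigmaP/sigmaP => ah s /ah /eq_safe; rewrite size_rcons leqW //; apply.
Qed.

Lemma F_dspP w : F_dsp (G := G) dtau (phi k) w <-> forall n, level_ok k (mkseq w n.+1).
Proof.
have ok := ord_level (i := k); rewrite k_gt0 leqnn in ok.
have ordk : ord (phi k) = k.-1 by rewrite (proj1 hier) // k_gt0 leqnn.
rewrite level_okE // /window_ok; split=> [Fw n|okw t].
  apply/implyP; rewrite !size_mkseq => kn; have lt := leq_trans (ok isT) kn.
  by rewrite -sat_mkseq //; apply: Fw.
move=> lt _; have := okw t.-1; rewrite prednK ?(leq_trans _ lt) // size_mkseq.
by rewrite -sat_mkseq //; move/implyP; apply; rewrite -(prednK k_gt0) -ordk.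
Qed.

End IterativeSynthesis.

(** * Direct synthesis *)

Lemma val_insub_bseq m (T : Type) (s : seq T) : size s <= m -> insub_bseq m s = s :> seq T.
Proof. by move=> le; rewrite /insub_bseq /insubd insubT. Qed.

Section DirectSynthesis.
Variables (R : realType) (d : nat) (G : arena R d) (dtau : R) (phi : dsp R d).
Local Notation S := (states G).
Local Notation A := (actions G).
Local Notation m := (ord phi).
Local Notation ok := (window_ok dtau phi m.+1).
Implicit Types (h : seq S) (D : strategy G).

Definition edge : rel S := fun s s' => [exists a, s' \in trans s a].

Lemma reach_sorted xi h : reach (G := G) xi h -> sorted edge h.
Proof.
move: h; apply: reach_ind => // h s _ srt [a _ sa].
case: h srt sa => // x h /= srt sa; rewrite rcons_path srt /=.
by apply/existsP; exists a.
Qed.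

Section OrderZero.
Hypothesis m0 : m = 0.

Lemma safety_regionP s : s \in safety_region G dtau phi <-> safe (G := G) ok [:: s].
Proof.
split=> [/bigcupP [Z /fintype.subsetP ZP sZ]|ss].
  exists (fun h => h != [::] /\ last (init G) h \in Z) => //.
  move=> h [h0 /ZP]; rewrite inE => /andP [sat_h /existsP [a /fintype.subsetP ah]].
  split; last by exists a => s' /ah; rewrite last_rcons; split; case: (h).
  have e : drop (size h).-1 h = [:: last (init G) h].
    by case: (lastP h) h0 => // h' x _; rewrite last_rcons size_rcons -cats1 drop_size_cat.
  by apply/implyP => _; rewrite -(satw_drop _ (n := (size h).-1)) e // m0.
apply/bigcupP; exists [set x | `[< safe (G := G) ok [:: x] >]]; last by rewrite inE; apply/asboolP.
apply/fintype.subsetP => x; rewrite inE => /asboolP /safeP [okx /set0Pn [a /sigmaP ax]].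
rewrite inE; apply/andP; split; first by move: okx; rewrite m0.
apply/existsP; exists a; apply/fintype.subsetP => y /ax sy.
by rewrite inE; apply/asboolP; apply: (safe_drop (n := 1) _ _ sy).
Qed.

Lemma safety_strategy_sigma h : h != [::] ->
  safety_strategy (G := G) dtau phi h = sigma (G := G) ok h.
Proof.
move=> h0; have eqv s : safe (G := G) ok [:: s] <-> safe (G := G) ok (rcons h s).
  have e : drop (size h) (rcons h s) = [:: s] by rewrite -cats1 drop_size_cat.
  by rewrite -e; apply: safe_window_drop => //; rewrite e m0.
apply/setP => a; rewrite inE; apply/fintype.subsetP/sigmaP => ah s /ah.
  by move/safety_regionP/eqv.
by move=> srs; apply/safety_regionP/eqv.
Qed.

End OrderZero.

Section PositiveOrder.
Hypothesis m_gt0 : 0 < m.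

Definition back_sound (back : m.-bseq S -> A -> {set m.-bseq S}) :=
  forall (h u : m.-bseq S) a, h \in back u a -> (h : seq S) != [::] /\
    exists2 s, s \in trans (last (init G) h) a &
      (u : seq S) = rcons h s \/ (u : seq S) = rcons (behead h) s.

Lemma rcons_nth h x : h != [::] -> h = rcons (take (size h).-1 h) (nth x h (size h).-1).
Proof.
move=> h0; have lt : (size h).-1 < size h by case: (h) h0.
by rewrite -take_nth // prednK ?take_size //; apply: leq_trans lt.
Qed.

Lemma last_take_pred h x : 1 < size h -> last x (take (size h).-1 h) = nth x h (size h).-2.
Proof.
move=> h1; rewrite -nth_last size_take_min (minn_idPl (leq_pred _)) nth_take //.
by case: (h) h1 => // ? [].
Qed.

Lemma back_ge2_sound : back_sound (@direct_back_ge2 R d G m).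
Proof.
move=> h u a; rewrite /direct_back_ge2.
set j := size u; set pre := take _ _; case: ifP => [/andP [/andP [j1 jm] mv]|_].
  rewrite inE => /eqP hp; have u0 : (u : seq S) != [::] by rewrite -size_eq0 -lt0n ltnW.
  split; first by rewrite hp -size_eq0 size_takel ?leq_pred // -lt0n -ltnS prednK // ltnW.
  exists (nth (init G) u j.-1); first by rewrite hp last_take_pred.
  by left; rewrite hp -rcons_nth.
case: ifP => [/andP [/andP [/eqP jm m1] mv]|_]; last by rewrite inE.
have j1 : 1 < j by rewrite jm.
have u0 : (u : seq S) != [::] by rewrite -size_eq0 -lt0n ltnW.
have pre0 : pre != [::].
  by rewrite -size_eq0 size_takel ?leq_pred // -lt0n -ltnS prednK // ltnW.
rewrite inE => /orP [/eqP hp|/existsP [s' /andP [_ /eqP hp]]]; rewrite hp; split=> //.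
  by exists (nth (init G) u j.-1); [rewrite last_take_pred|left; rewrite -rcons_nth].
exists (nth (init G) u j.-1); last by right; rewrite /= -rcons_nth.
have lp : last (init G) pre = nth (init G) u j.-2 by apply: last_take_pred.
by rewrite -lp in mv; rewrite /=; case: (pre) pre0 mv.
Qed.

Lemma back_direct_sound : back_sound (@direct_back R d G m).
Proof.
rewrite /direct_back; case: eqP => [m1|_]; last exact: back_ge2_sound.
move=> h u a; rewrite inE => /existsP [s /existsP [s' /and3P [/eqP -> /eqP -> sa]]].
by split=> //; exists s => //; right.
Qed.

Lemma back_direct_complete (h u : m.-bseq S) a s :
    (h : seq S) != [::] -> sorted edge h -> s \in trans (last (init G) h) a ->
    (u : seq S) = (if size h < m then rcons h s else rcons (behead h) s) ->
  h \in direct_back u a.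
Proof.
move=> h0 srt sa eu; have hm := size_bseq h.
rewrite /direct_back; case: eqP => [m1|m1].
  have h1 : size h = 1.
    by apply/eqP; rewrite eqn_leq (leq_trans hm (eq_leq m1)) lt0n size_eq0.
  have [x hx] : exists x, h = [:: x] :> seq S by case: (h : seq S) h1 => // x []; exists x.
  rewrite inE; apply/existsP; exists s; apply/existsP; exists x.
  by rewrite eu hx /= {1}m1 !eqxx; rewrite hx in sa.
have m2 : 1 < m by rewrite ltn_neqAle eq_sym m_gt0 andbT; apply/eqP.
have h_gt0 : 0 < size h by rewrite lt0n size_eq0.
have [v [eu' v0 lv sv]] : exists v, [/\ (u : seq S) = rcons v s, v != [::],
    last (init G) v = last (init G) h & v = if size h < m then (h : seq S) else behead h].
  case: ltnP eu => le eu; first by exists h.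
  have h1 := leq_trans m2 le.
  exists (behead h); split=> //; rewrite -drop1 ?last_drop //.
  by rewrite -size_eq0 size_drop subn_eq0 -ltnNge.
have szu : size u = (size v).+1 by rewrite eu' size_rcons.
have v_gt0 : 0 < size v by rewrite lt0n size_eq0.
have mv : nth (init G) u (size u).-1 \in trans (nth (init G) u (size u).-2) a.
  rewrite szu /= eu' nth_rcons ltnn eqxx nth_rcons prednK // leqnn.
  by rewrite nth_last lv.
have pre : take (size u).-1 u = v by rewrite szu /= eu' -cats1 take_size_cat.
rewrite /direct_back_ge2 mv pre szu ltnS v_gt0 m2 !andbT /=.
have um : (size v).+1 <= m by rewrite -szu; apply: size_bseq.
case: ltnP => vm.
  by rewrite inE; move: sv; case: ltnP => [_ ->//|le ev]; move: vm; rewrite ev size_behead; lia.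
have -> : (size v).+1 == m by rewrite eqn_leq um.
rewrite inE; move: sv; case: ltnP => [_ ->|le ev]; first by rewrite eqxx.
apply/orP; right; apply/existsP.
have h1 := leq_trans m2 le.
case: (h : seq S) h1 ev srt => [|x [|y h']] //= _ ev srt.
exists x; rewrite ev eqxx andbT eu' ev /=.
by case/andP: srt.
Qed.

Variables (back : m.-bseq S -> A -> {set m.-bseq S}).
Variables (xi : {ffun m.-bseq S -> {set A}}) (n : nat).
Let xi0 := direct_init G dtau m phi.
Hypothesis run : wl_run back
  ([set h : m.-bseq S | (size h == m) && (xi0 h == set0)], xi0) xi n.

Let lastm h : m.-bseq S := insub_bseq m (drop (size h - m) h).

Lemma lastmE h : lastm h = drop (size h - m) h :> seq S.
Proof. by rewrite val_insub_bseq // size_drop; lia. Qed.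

Lemma lastm_neq0 h : h != [::] -> (lastm h : seq S) != [::].
Proof.
by rewrite -!size_eq0 lastmE size_drop; move: m_gt0; move: (size h) (m) => a b; lia.
Qed.

Lemma sigma_lastm h : h != [::] -> sigma (G := G) ok (lastm h) = sigma (G := G) ok h.
Proof.
rewrite -size_eq0 lastmE => h0; have [le|lt] := leqP m (size h).
  by apply: sigma_window_drop; rewrite ?size_drop; lia.
by rewrite (eqP (ltnW lt : size h - m == 0)) drop0.
Qed.

Lemma direct_initP (h : m.-bseq S) a : m <= size h -> a \in xi0 h ->
  forall s, s \in trans (last (init G) h) a -> satw dtau phi (rcons h s).
Proof.
move=> mh; have szh : size h = m by apply/eqP; rewrite eqn_leq size_bseq.
rewrite ffunE ltnNge mh inE => /forall_inP sat_h s /sat_h.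
by rewrite /satw size_rcons szh.
Qed.

Lemma direct_ge_sigma h : back_sound back -> h != [::] -> sigma (G := G) ok h \subset xi (lastm h).
Proof.
move=> snd h0; rewrite -sigma_lastm //.
pose eta (v : m.-bseq S) := [set a in sigma (G := G) ok v | (v : seq S) != [::]].
suff /fintype.subsetP sub : eta (lastm h) \subset xi (lastm h).
  by apply/fintype.subsetP => a ah; apply: sub; rewrite inE ah lastm_neq0.
apply: (wl_run_max (eta := eta) _ run) => [v||v u a].
- by rewrite /= inE => /andP [_ /eqP].
- move=> v; apply/fintype.subsetP => a; rewrite inE => /andP [/sigmaP av v0].
  rewrite ffunE; case: ltnP => [_|mv]; first by rewrite inE.
  have szv : size v = m by apply/eqP; rewrite eqn_leq size_bseq.
  rewrite inE; apply/forall_inP => s /av /safe_ok.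
  by rewrite /window_ok /satw size_rcons szv leqnn.
rewrite inE => /andP [/sigmaP av v0] /snd [_ [s /av srs eu]].
have su : safe (G := G) ok u.
  case: eu => ->//; have -> : rcons (behead v) s = drop 1 (rcons v s).
    by case: (v : seq S) v0 => //= x v' _; rewrite drop0.
  by apply: safe_drop; rewrite ?size_rcons ?ltnS ?lt0n ?size_eq0.
have [_ /set0Pn [b bu]] := proj1 (safeP _ _) su; apply/set0Pn; exists b.
by rewrite inE bu /=; case: eu => ->; rewrite -size_eq0 size_rcons.
Qed.

Lemma direct_le_sigma h : back =2 @direct_back R d G m ->
  h != [::] -> sorted edge h -> ok h -> xi (lastm h) \subset sigma (G := G) ok h.
Proof.
move=> backE.
pose Z h := [/\ h != [::], sorted edge h, ok h & xi (lastm h) != set0].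
have closed h' a s : h' != [::] -> sorted edge h' -> ok h' -> a \in xi (lastm h') ->
    s \in trans (last (init G) h') a -> Z (rcons h' s).
  move=> h0 srt okh ah sa.
  have h_gt0 : 0 < size h' by rewrite lt0n size_eq0.
  have lt : size h' - m < size h' by lia.
  have lastE : last (init G) (lastm h') = last (init G) h' by rewrite lastmE last_drop.
  split; first by rewrite -size_eq0 size_rcons.
  - case: (h') h0 srt sa => // x h1 _ /= srt sa; rewrite rcons_path srt /=.
    by apply/existsP; exists a.
  - apply/implyP; rewrite size_rcons ltnS => mh.
    rewrite -(satw_drop _ (n := size h' - m)) drop_rcons ?leq_subr //.
      rewrite -lastmE; apply: (direct_initP (a := a)); rewrite ?lastE //.
        by rewrite lastmE size_drop subKn.
      exact: (fintype.subsetP (wl_run_sub _ run) _ ah).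
    by rewrite size_rcons size_drop subKn.
  apply: (wl_run_closed (D := [set: m.-bseq S]) _ run (h := lastm h') (a := a)) => //.
    move=> v _ v0; rewrite inE v0 eqxx andbT eqn_leq size_bseq /= leqNgt.
    apply/negP => vm; have /eqP := v0; apply/negP; rewrite ffunE vm.
    by rewrite -card_gt0 cardsT actions_neq0.
  rewrite backE; apply: (back_direct_complete (s := s)); rewrite ?lastE ?lastm_neq0 //.
    by rewrite lastmE; apply: drop_sorted.
  rewrite !lastmE size_rcons size_drop; case: ltnP => le.
    rewrite (_ : size h' - m = 0); last by lia.
    by rewrite (_ : (size h').+1 - m = 0) ?drop0 //; lia.
  rewrite subSn; last by lia.
  rewrite -drop1 drop_drop add1n drop_rcons //; lia.
move=> h0 srt okh; apply/fintype.subsetP => a ah; apply/sigmaP => s sa.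
exists Z; first exact: closed ah sa.
move=> h' [h'0 srt' okh' /set0Pn [b bh']]; split=> //.
by exists b => s'; apply: closed.
Qed.

End PositiveOrder.
End DirectSynthesis.

(** * Comparison and complexity *)

Section DirectStrategy.
Variables (R : realType) (d : nat) (G : arena R d) (dtau : R) (phi : dsp R d).
Local Notation ok := (window_ok dtau phi (ord phi).+1).

Lemma direct_synthesis_exists
    (back : forall m, m.-bseq (states G) -> actions G -> {set m.-bseq (states G)}) :
  exists D, direct_synthesis dtau back phi D.
Proof.
rewrite /direct_synthesis; case: eqP => _; first by eexists.
set m := ord phi; set xi0 := direct_init G dtau m phi.
have [xi [n run]] :=
  wl_run_exists (back m) ([set h : m.-bseq (states G) | (size h == m) && (xi0 h == set0)], xi0).
by eexists; exists xi, n.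
Qed.

Variables (F : (nat -> states G) -> Prop) (D : strategy G).
Hypothesis FP : forall w, F w <-> forall n, ok (mkseq w n.+1).
Hypothesis wF : exists xi : strategy G, winning F xi.

Lemma direct_sigma h : direct_synthesis dtau (@direct_back R d G) phi D ->
  reach (sigma (G := G) ok) h -> D h = sigma (G := G) ok h.
Proof.
move=> dD rh; have h0 : h != [::] by case: rh; case: (h).
move: dD; rewrite /direct_synthesis; case: eqP => [m0 ->|/eqP m0].
  exact: safety_strategy_sigma.
have m_gt0 : 0 < ord phi by rewrite lt0n.
case=> xi [n [run ->]]; apply/eqP; rewrite eqEsubset; apply/andP; split.
  apply: (direct_le_sigma m_gt0 run) => //; first exact: reach_sorted rh.
  exact/safe_ok/(reach_sigma_safe FP wF).
by apply: (direct_ge_sigma m_gt0 run) => //; apply: back_direct_sound.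
Qed.

Lemma direct_ge2_sigma h : direct_synthesis dtau (@direct_back_ge2 R d G) phi D ->
  winning F D -> reach (sigma (G := G) ok) h -> D h = sigma (G := G) ok h.
Proof.
move=> dD wD rh.
have geD h' : h' != [::] -> sigma (G := G) ok h' \subset D h'.
  move: dD; rewrite /direct_synthesis; case: eqP => [m0 ->|/eqP m0].
    by move=> h0; rewrite safety_strategy_sigma.
  have m_gt0 : 0 < ord phi by rewrite lt0n.
  case=> xi [n [run ->]] h0; apply: (direct_ge_sigma m_gt0 run) => //.
  exact: back_ge2_sound.
have nz xi h' : reach (G := G) xi h' -> h' != [::] by case; case: h'.
have rD : reach D h.
  move: h rh; apply: reach_ind => [|h s rh rD [a ah sa]]; first exact: reach_init.
  by apply: reach_rcons => //; exists a => //; apply: (fintype.subsetP (geD _ (nz _ _ rh))).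
apply/eqP; rewrite eqEsubset geD ?(nz _ _ rh) // andbT.
exact: (winning_sub_sigma FP wD).
Qed.

End DirectStrategy.

Section Comparison.
Variables (R : realType) (d : nat) (G : arena R d) (dtau : R).
Variables (k : nat) (phi : nat -> dsp R d).
Local Notation S := (states G).
Local Notation A := (actions G).
Hypothesis k_gt0 : 0 < k.
Hypothesis hier : hierarchical dtau S k phi.
Variable o : synthesis G.
Hypothesis io : iterative_synthesis dtau k phi o.
Local Notation F := (@F_dsp R d G dtau (phi k)).
Local Notation sg := (sigma (G := G) (level_ok dtau phi k)).

Lemma sigma_max_permissive (D : strategy G) : (exists xi, winning F xi) ->
    (forall h, reach sg h -> D h = sg h) ->
  max_permissive F D /\
  forall w : seq S, ohead w = Some (init G) -> consistent D (Fin w) -> k <= size w ->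
    lookup (act o k) (drop (size w - k) w) = D w.
Proof.
move=> wF Dsg; have FP := F_dspP hier k_gt0.
have agr h : reach sg h -> agrees (level_ok dtau phi k) D h by move/Dsg/agrees_eq.
split=> [|w w0 con kw]; first exact: (agrees_max_permissive FP wF agr).
have rw : reach sg w by apply/(agrees_reach w agr).
rewrite (lookup_act hier io k_gt0 kw) ?Dsg //.
exact: (reach_sigma_safe FP wF).
Qed.

Lemma window_max_permissive (xi : strategy G) : max_permissive F xi ->
  max_permissive F (window_strategy xi (act o k)).
Proof.
move=> mxi; have FP := F_dspP (G := G) hier k_gt0.
have wF : exists xi, winning F xi by exists xi; case: mxi.
apply: (agrees_max_permissive FP wF) => h rh.
have := max_permissive_agrees FP mxi rh; rewrite /agrees /move /window_strategy.
case: ltnP => // kh _; rewrite (lookup_act hier io k_gt0 kh) //.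
exact: (reach_sigma_safe FP wF).
Qed.

Lemma level_ok_ord : level_ok (G := G) dtau phi k = window_ok dtau (phi k) (ord (phi k)).+1.
Proof. by rewrite level_okE // (proj1 hier) ?k_gt0 ?leqnn // prednK. Qed.

Lemma direct_max_permissive (D : strategy G) : (exists xi, winning F xi) ->
    direct_synthesis dtau (@direct_back R d G) (phi k) D \/
    direct_synthesis dtau (@direct_back_ge2 R d G) (phi k) D /\ winning F D ->
  max_permissive F D /\
  forall w : seq S, ohead w = Some (init G) -> consistent D (Fin w) -> k <= size w ->
    lookup (act o k) (drop (size w - k) w) = D w.
Proof.
move=> wF dD; apply: sigma_max_permissive => // h.
have FP := F_dspP (G := G) hier k_gt0; rewrite level_ok_ord in FP *.
case: dD => [dD|[dD wD]] rh; first exact: (direct_sigma FP wF dD rh).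
exact: (direct_ge2_sigma FP dD wD rh).
Qed.

Local Notation a := #|A|.
Local Notation n := #|{: S}|.
Local Notation c i := (#|cand o i| * a * n).

Lemma states_gt0 : 0 < n. Proof. by apply/card_gt0P; exists (init G). Qed.

Lemma pops_le i : i < k -> pops o i.+1 <= #|cand o i.+1|.
Proof.
move=> ik; case: io => _ /(_ i ik) [_ run _] _ _.
apply: leq_trans (wl_run_potential run) _; rewrite /potential /=.
set xi0 := iter_init _ _; set N := [set h | xi0 h != set0].
have NC : N \subset cand o i.+1.
  apply/fintype.subsetP => s; rewrite inE ffunE.
  by case: ifP => //; rewrite eqxx.
rewrite -(cardsID N (cand o i.+1)) (setIidPr NC) addnC leq_add2l subset_leq_card //.
by apply/fintype.subsetP => s; rewrite !inE => /andP [-> ->].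
Qed.

Lemma sum_moves_le i (C : {set i.-tuple S})
    (B : i.-tuple S -> {set A}) (f : i.-tuple S -> A -> {set S}) :
  \sum_(s in C) (1 + \sum_(b in B s) (1 + #|f s b|)) <= #|C| * (1 + a * (1 + n)).
Proof.
rewrite -sum_nat_const; apply: leq_sum => s _; rewrite leq_add2l.
apply: (@leq_trans (\sum_(b in B s) (1 + n))).
  by apply: leq_sum => b _; rewrite leq_add2l max_card.
by rewrite sum_nat_const leq_mul2r max_card orbT.
Qed.

Lemma level_cost_le i : i < k -> level_cost o i <= #|win o i| * n + 6 * c i.+1.
Proof.
move=> ik; rewrite /level_cost.
have lhs1 : \sum_(v in win o i) \sum_(s : S) 1 = #|win o i| * n.
  by rewrite sum_nat_const sum1_card.
have lhs3 : \sum_(b : A) \sum_(s : S) 1 = a * n by rewrite sum_nat_const sum1_card.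
rewrite lhs1 lhs3 sum1_card -!addnA leq_add2l.
have := sum_moves_le (cand o i.+1) (fun s => act o i [tuple of behead s])
  (fun s b => trans (tlast s) b).
have := pops_le ik; have := actions_neq0 G; have := states_gt0.
move: (\sum_(s in cand o i.+1) _) (pops o i.+1) (#|cand o i.+1|) (a) (n) => x q p y z z0 y0 qp xp.
have e1 : q * (1 + y * z) <= p + p * y * z.
  by apply: leq_trans (_ : p * (1 + y * z) <= _); [rewrite leq_mul2r qp orbT|lia].
have e2 : p * y <= p * y * z by rewrite leq_pmulr.
have e3 : p <= p * y by rewrite leq_pmulr.
lia.
Qed.

Lemma win_le i : 0 < i <= k -> #|win o i| * n <= c i.
Proof.
case: i => // i ik; rewrite leq_mul2r; apply/orP; right.
apply: (@leq_trans #|cand o i.+1|); last by rewrite leq_pmulr // actions_neq0.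
case: io => _ /(_ i ik) [_ _ ->] _ _; apply/subset_leq_card/fintype.subsetP => s.
by rewrite inE => /andP [].
Qed.

Lemma stored_le i : i < k -> #|stored (hat o i.+1)| <= #|cand o i.+1|.
Proof.
move=> ik; apply/subset_leq_card/fintype.subsetP => s; rewrite inE.
move/(hat_spec hier io k_gt0 s (ik : 0 < i.+1 <= k)).1 => ss.
apply: (safe_in_cand hier io ik).
by apply: (safe_hier_level hier k_gt0 _ _ ss); rewrite ?size_tuple.
Qed.

Lemma hat_cost_le i : i.+1 < k -> hat_cost o i <= 4 * c i.+2.
Proof.
move=> ik; rewrite /hat_cost sum1_card.
pose P (s : i.+1.-tuple S) := [exists s', [tuple of rcons s s'] \in stored (hat o i.+2)].
rewrite -[X in _ + X <= _]/(\sum_(s | P s) (1 + \sum_b (1 + #|trans (tlast s) b|))).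
have PC : #|[set s | P s]| <= #|stored (hat o i.+2)|.
  apply: leq_trans (leq_imset_card (fun s => [tuple of belast (thead s) (behead s)]) _).
  apply/subset_leq_card/fintype.subsetP => s; rewrite inE => /existsP [s' ss'].
  apply/imsetP; exists [tuple of rcons s s'] => //; apply: val_inj.
  have /(congr1 val) /= := tuple_eta [tuple of rcons s s'].
  by rewrite [RHS]lastI => /rcons_inj [].
have := sum_moves_le [set s | P s] (fun=> setT) (fun s b => trans (tlast s) b).
rewrite [X in X <= _](eq_big P (fun s => 1 + \sum_b (1 + #|trans (tlast s) b|))); first last.
- by move=> s _; congr (_ + _); apply: eq_bigl => b; rewrite inE.
- by move=> s; rewrite inE.
have := stored_le ik; have := actions_neq0 G; have := states_gt0; move: PC.
move: (\sum_(s | P s) _) (#|[set s | P s]|) (#|stored _|) (#|cand o i.+2|) (a) (n).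
move=> x p q r y z pq z0 y0 qr xp.
have e1 : x <= r * (1 + y * (1 + z)).
  by apply: leq_trans xp _; rewrite leq_mul2r (leq_trans pq) ?orbT.
have e2 : r * y <= r * y * z by rewrite leq_pmulr.
have e3 : r <= r * y by rewrite leq_pmulr.
lia.
Qed.

Let bound := \sum_(1 <= i < k.+1) c i.

Lemma boundE : bound = \sum_(i < k) c i.+1.
Proof. by rewrite /bound big_add1 big_mkord. Qed.

Lemma cost_le : cost k o <= n + 11 * bound.
Proof.
have le1 : \sum_(i < k) level_cost o i <= \sum_(i < k) #|win o i| * n + 6 * bound.
  by rewrite boundE big_distrr -big_split; apply: leq_sum => i _; apply: level_cost_le.
have le2 : \sum_(i < k) #|win o i| * n <= n + bound.
  rewrite boundE; case: (k) k_gt0 (fun i => @win_le i) => // k' _ wle.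
  rewrite big_ord_recl big_ord_recr /= leq_add //.
    rewrite -[X in _ <= X]mul1n leq_mul2r; apply/orP; right.
    by apply: leq_trans (max_card _) _; rewrite card_tuple.
  by apply: leq_trans (leq_addr _ _); apply: leq_sum => i _; exact: (wle i.+1 (ltnW (ltn_ord i))).
have le3 : \sum_(i < k.-1) hat_cost o i <= 4 * bound.
  rewrite boundE; case: (k) k_gt0 (fun i => @hat_cost_le i) => // k' _ hle.
  rewrite big_ord_recl mulnDr; apply: leq_trans (leq_addl _ _).
  by rewrite big_distrr; apply: leq_sum => i _; apply: hle; rewrite ltnS.
rewrite /cost; lia.
Qed.

Lemma states_le_bound : 0 < bound -> n <= bound.
Proof.
rewrite /bound -!big_distrl /= -mulnA; move: (\sum_(_ <= i < _) _) => s.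
by rewrite muln_gt0 => /andP [s0 an]; rewrite mulnA leq_pmull // muln_gt0 s0 actions_neq0.
Qed.

Lemma bound_le : bound <= k * (n ^ k.+1 * a).
Proof.
rewrite boundE -[X in _ <= X * _]card_ord -sum_nat_const; apply: leq_sum => i _.
rewrite mulnAC leq_mul2r expnSr; apply/orP; right; rewrite leq_mul2r; apply/orP; right.
apply: leq_trans (max_card _) _; rewrite card_tuple.
by rewrite leq_pexp2l // states_gt0.
Qed.

End Comparison.

Theorem theorem3 :
  exists K : nat, forall k : nat, exists Kk : nat,
  forall (R : realType) (d : nat) (G : arena R d) (dtau : R)
    (phi : nat -> dsp R d),
  0 < k -> (0 < dtau)%R -> hierarchical dtau (states G) k phi ->
  [/\ forall i (C : {set i.+1.-tuple (states G)}), wl_terminates (iter_back C),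
      exists o : synthesis G, iterative_synthesis dtau k phi o
    & forall o : synthesis G, iterative_synthesis dtau k phi o ->
  [/\ (* 1 *)
      forall i, i < k ->
        win o i.+1 = winning_windows G dtau (phi i.+1) i.+1 /\
        (forall s, s \in winning_windows G dtau (phi i.+1) i.+1 ->
           act o i.+1 s = safe_actions dtau phi s),
      (* 2 *)
      let F := @F_dsp R d G dtau (phi k) in
      let same (D : strategy G) :=
        forall w : seq (states G), ohead w = Some (init G) ->
          consistent D (Fin w) -> k <= size w ->
          lookup (act o k) (drop (size w - k) w) = D w in
      forall xi : strategy G, max_permissive F xi ->
        [/\ max_permissive F (window_strategy xi (act o k)),
            exists D, direct_synthesis dtau (@direct_back R d G) (phi k) D,
            forall D, direct_synthesis dtau (@direct_back R d G) (phi k) D ->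
              max_permissive F D /\ same D
          & forall D, direct_synthesis dtau (@direct_back_ge2 R d G) (phi k) D ->
              winning F D -> max_permissive F D /\ same D],
      (* 3 *)
      let F := @F_hier R d G dtau k phi in
      (exists xi : strategy G, winning F xi) ->
        max_permissive F (window_strategy (hat_strategy o) (act o k))
    & (* 4 *)
      let bound :=
        \sum_(1 <= i < k.+1) #|cand o i| * #|actions G| * #|` states G| in
      [/\ 0 < bound -> cost k o <= K * bound,
          bound <= Kk * (#|` states G| ^ k.+1 * #|actions G|)
        & cost k o <= Kk * (#|` states G| ^ k.+1 * #|actions G|)]]].
Proof.
exists 12 => k; exists (11 * k + 1) => R d G dtau phi k_gt0 _ hier.
split; [by move=> i C; apply: worklist_terminates|exact: iterative_synthesis_exists|].
move=> o io; split.
- by move=> i ik; apply: (win_act_correct hier io).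
- move=> F same xi mxi; have wF : exists xi, winning F xi by exists xi; case: mxi.
  split; first exact: (window_max_permissive k_gt0 hier io).
  + exact: direct_synthesis_exists.
  + by move=> D dD; apply: (direct_max_permissive k_gt0 hier io wF); left.
  + by move=> D dD wD; apply: (direct_max_permissive k_gt0 hier io wF); right.
- by move=> F wF; apply: (hier_max_permissive hier io k_gt0).
move=> bound; rewrite /bound !cardfE.
have := cost_le k_gt0 hier io; have := @states_le_bound R d G k o; have := @bound_le R d G k o.
have := actions_neq0 G; have := states_gt0 G.
set b := \sum_(_ <= i < _) _; set n := #|_|; set a := #|_| => n0 a0 bk nb cb.
have nn : n <= n ^ k.+1 * a.
  by rewrite expnS -mulnA leq_pmulr // muln_gt0 expn_gt0 n0.
split=> [b0||]; first by have := nb b0; lia.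
  by apply: leq_trans bk _; rewrite leq_mul2r; apply/orP; right; lia.
by move: nn bk cb; move: (n ^ k.+1 * a) => N; nia.
Qed.
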